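(* Let $\mathcal{G}$ be a group space on $X$. Assume that $X$ is connected, let $q : Y \to X$ be a Galois cover with automorphism group $\pi := \mathrm{Aut}_X(Y)$, and set $\widehat{\mathcal{G}} := q^*\mathcal{G}$. (1) If $\mathcal{P}$ is a right $\mathcal{G}$-torsor such that $\widehat{\mathcal{P}} := q^*\mathcal{P}$ is isomorphic to $\widehat{\mathcal{G}}$ as a $\widehat{\mathcal{G}}$-torsor, then there exist a crossed morphism $\psi : \pi \to \Gamma(Y,\widehat{\mathcal{G}})$ and an isomorphism of $\mathcal{G}$-torsors $\mathcal{P} \simeq \pi \backslash \widehat{\mathcal{G}}$, where $f \in \pi$ acts to the left on $g \in \widehat{\mathcal{G}}_y$ via $\sigma_f(g) := \tau_f\big(\psi_f(y)\, g\big)$ and $\tau$ is the canonical $\pi$-equivariant structure of $\widehat{\mathcal{G}}$. (2) Moreover, if $\psi$ and $\psi'$ are crossed morphisms from $\pi$ to $\Gamma(Y,\widehat{\mathcal{G}})$, then the associated $\mathcal{G}$-torsors $\mathcal{P}$ and $\mathcal{P}'$ (the quotients of $\widehat{\mathcal{G}}$ by the actions defined as in (1) by $\psi$ and $\psi'$ respectively) are isomorphic over $X$ if and only if $\psi$ and $\psi'$ are conjugate under the left action $\bullet$ of $\Gamma(Y,\widehat{\mathcal{G}})$. So the set of isomorphism classes of right $\mathcal{G}$-torsors that become trivial after pullback to $Y$ is in bijection with the group cohomology set $$H^1_\tau\big(\pi,\Gamma(Y,\widehat{\mathcal{G}})\big) := \Gamma(Y,\widehat{\mathcal{G}}) \,\backslash\,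 Z^1_\tau\big(\pi,\Gamma(Y,\widehat{\mathcal{G}})\big).$$
   Context: The statement is understood in either of two categories: (T) topological spaces and continuous maps; (A) complex analytic manifolds and holomorphic maps, where group spaces $p:\mathcal{G}\to X$ are required to be submersions so that fibre products exist. A group space over $X$ is a space $p : \mathcal{G} \to X$ over $X$ with morphisms over $X$, $\mathcal{G} \times_X \mathcal{G} \to \mathcal{G}$ (multiplication) and $\mathcal{G} \to \mathcal{G}$ (inversion), and a section $\varepsilon$ of $p$, making each fibre $\mathcal{G}_x$ a group with neutral element $\varepsilon(x)$. A right $\mathcal{G}$-space is a space $\mathcal{P}$ over $X$ with a morphism over $X$, $\mathcal{P} \times_X \mathcal{G} \to \mathcal{P}$, which is fibrewise a right group action; morphisms are equivariant morphisms over $X$. A right $\mathcal{G}$-torsor is a right $\mathcal{G}$-space $\mathcal{P}$ such that every point of $X$ has an open neighbourhood $U$ with an isomorphism of right $\mathcal{G}|_U$-spaces $\mathcal{G}|_U \simeq \mathcal{P}|_U$ ($\mathcal{G}|_U$ acting on itself by right translations). It is trivial if it is isomorphic to $\mathcal{G}$ as a right $\mathcal{G}$-torsor. A Galois cover $q : Y \to X$ is a covering with $Y$ connected such that the induced map $\pi\backslash Y \to X$, $\pi := \mathrm{Aut}_X(Y)$, is an isomorphism (equivalently, $\pi$ acts transitively on the fibres of $q$). The pullback $\widehat{\mathcal{G}} = q^*\mathcal{G} = \{(\xi,g) \in Y \times \mathcal{G} : q(\xi) = p(g)\}$ is a group space over $Y$, and $q^*\mathcal{P} = Y\times_X\mathcal{P}$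 is a $\widehat{\mathcal{G}}$-torsor. ''Trivial after pullback to $Y$'' means $q^*\mathcal{P}\simeq\widehat{\mathcal{G}}$ as $\widehat{\mathcal{G}}$-torsors. The canonical $\pi$-equivariant structure of $\widehat{\mathcal{G}}$ is the family $\tau_f(\xi,g) = (f(\xi),g)$, $f\in\pi$; each $\tau_f$ covers $f$, is a group isomorphism on fibres, $\tau_{f_1\circ f_2}=\tau_{f_1}\circ\tau_{f_2}$, and $\mathcal{G} \simeq \pi\backslash\widehat{\mathcal{G}}$ for this action. $\Gamma(Y,\widehat{\mathcal{G}})$ is the group of (continuous, resp. holomorphic) sections of $\widehat{\mathcal{G}}$ under pointwise multiplication. $\pi$ acts on it to the right by group automorphisms via $\alpha^f := \tau_f^{-1}\circ\alpha\circ f$. A crossed morphism $\psi : \pi\to\Gamma(Y,\widehat{\mathcal{G}})$ is a map $f\mapsto\psi_f$ with $\psi_{f_1\circ f_2} = \psi_{f_1}^{f_2}\cdot\psi_{f_2}$; the set of these is $Z^1_\tau(\pi,\Gamma(Y,\widehat{\mathcal{G}}))$. $\Gamma(Y,\widehat{\mathcal{G}})$ acts on it to the left by $(\alpha\bullet\psi)_f := \alpha^f\cdot\psi_f\cdot\alpha^{-1}$. For a crossed morphism $\psi$, the maps $\sigma_f$ in the claim satisfy $\sigma_f(h g) = \sigma_f(h)\,\tau_f(g)$ for $g,h\in\widehat{\mathcal{G}}_y$, so the right translation action of $\widehat{\mathcal{G}}$ on itself descends to an action of $\mathcal{G}\simeq\pi\backslash\widehat{\mathcal{G}}$ (quotient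 via $\tau$) on $\pi\backslash\widehat{\mathcal{G}}$ (quotient via $\sigma$); this is its $\mathcal{G}$-torsor structure. *)

(* Defs.v *)
From HB Require Import structures.
From mathcomp Require Import all_boot all_order all_algebra.
From mathcomp Require Import complex.
From mathcomp Require Import all_classical all_reals all_analysis.

Set Implicit Arguments.
Unset Strict Implicit.
Unset Printing Implicit Defensive.

Import Order.TTheory GRing.Theory Num.Theory.
Import numFieldNormedType.Exports.
Local Open Scope classical_set_scope.
Local Open Scope ring_scope.

(* The ascription to numFieldType is what gives R[i] and 'rV[R[i]]_n their
   norm, so that [differentiable] below means complex differentiable. *)
Definition Cplx (R : realType) : numFieldType := R[i]%C.

(** * Spaces and morphisms *)

(* Top: topological spaces and continuous maps.
   Hol: complex analytic manifolds and holomorphic maps. *)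
Inductive category := Top | Hol.

(* Complex manifolds are presented as spaces with functions: [funs M x h] says
   that [h] is holomorphic in a neighbourhood of [x], so that the structure
   sheaf is O_M(U) = {h | forall x in U, funs M x h}; the values of [h] away
   from [x] are irrelevant (axiom [funs_local] of [is_manifold]). *)
Definition structure (R : realType) (k : category) (M : Type) : Type :=
  match k with
  | Top => unit
  | Hol => M -> (M -> Cplx R) -> Prop
  end.

Record catSpace (R : realType) (k : category) := CatSpace {
  pts :> topologicalType ;
  funs : structure R k pts
}.

Definition pulls_back (R : realType) (k : category) (M N : Type) :
    structure R k M -> structure R k N -> (M -> N) -> M -> Prop :=
  match k with
  | Top => fun _ _ _ _ => True
  | Hol => fun OM ON f x => forall h, ON (f x) h -> OM x (h \o f)
  end.

Section Spaces.
Context {R : realType} {k : category}.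
Implicit Types X Y : catSpace R k.

Definition morphism_at X Y (f : X -> Y) (x : X) : Prop :=
  {for x, continuous f} /\ pulls_back (funs X) (funs Y) f x.

(* A morphism defined on an open set U is represented by a total function,
   whose values outside U are irrelevant. *)
Definition morphism_on X Y (U : set X) (f : X -> Y) : Prop :=
  forall x, U x -> morphism_at f x.

Definition morphism X Y (f : X -> Y) : Prop := forall x, morphism_at f x.

Definition iso_on X Y (U : set X) (V : set Y) (f : X -> Y) (g : Y -> X) : Prop :=
  [/\ morphism_on U f, morphism_on V g,
      forall x, U x -> V (f x) /\ g (f x) = x &
      forall y, V y -> U (g y) /\ f (g y) = y].

Definition isomorphism X Y (f : X -> Y) : Prop :=
  exists g : Y -> X, [/\ morphism f, morphism g, cancel f g & cancel g f].

End Spaces.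

(** * Complex manifolds *)

Definition affine_space (R : realType) (n : nat) : catSpace R Hol :=
  @CatSpace R Hol 'rV[Cplx R]_n
    (fun x h => \forall z \near x, differentiable (h : _ -> Cplx R) z).

Definition chart_at (R : realType) (M : catSpace R Hol) (n : nat) (x : M)
    (phi : M -> affine_space R n) (phi' : affine_space R n -> M) : Prop :=
  exists (U : set M) (V : set (affine_space R n)),
    [/\ open U, open V, U x & iso_on U V phi phi'].

Definition funs_local (R : realType) (M : catSpace R Hol) : Prop :=
  forall (x : M) (h h' : M -> Cplx R),
    (\forall z \near x, h z = h' z) -> funs M x h -> funs M x h'.

Definition is_manifold (R : realType) (M : catSpace R Hol) : Prop :=
  [/\ hausdorff_space M, funs_local M &
      forall x : M, exists n phi phi', @chart_at R M n x phi phi'].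

Definition is_space (R : realType) (k : category) : catSpace R k -> Prop :=
  match k with
  | Top => fun _ => True
  | Hol => fun M => is_manifold M
  end.

Definition holomorphic_submersion (R : realType) (M N : catSpace R Hol)
    (p : M -> N) : Prop :=
  forall x : M, exists n m (phi : M -> affine_space R n) phi'
      (psi : N -> affine_space R m) psi',
    [/\ chart_at x phi phi', chart_at (p x) psi psi' &
        forall w : 'rV[Cplx R]_m, exists v : 'rV[Cplx R]_n,
          'd (psi \o p \o phi' : 'rV[Cplx R]_n -> 'rV[Cplx R]_m) (phi x) v = w].

Definition submersive (R : realType) (k : category) :
    forall X Y : catSpace R k, (X -> Y) -> Prop :=
  match k with
  | Top => fun _ _ _ => True
  | Hol => fun X Y p => holomorphic_submersion p
  end.

(** * Fibre products and orbit spaces *)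

(* Holomorphic functions on a subset A of a product M x N of manifolds: those
   which locally on A are of the form F(u_1, ..., u_m, v_1, ..., v_n) with u_i
   holomorphic on M, v_j holomorphic on N and F holomorphic on an open subset
   of C^(m+n), that is, the local restrictions to A of the holomorphic
   functions on M x N. *)
Definition product_funs (R : realType) (k : category) (M N : topologicalType)
    (A : set (M * N)) :
    structure R k M -> structure R k N -> structure R k A :=
  match k with
  | Top => fun _ _ => tt
  | Hol => fun OM ON w h =>
      exists m n (u : 'I_m -> M -> Cplx R) (v : 'I_n -> N -> Cplx R)
        (F : 'rV[Cplx R]_(m + n) -> Cplx R),
        let uv (z : M * N) := row_mx (\row_i u i z.1) (\row_j v j z.2) in
        [/\ forall i, OM (val w).1 (u i),
            forall j, ON (val w).2 (v j),
            \forall t \near uv (val w), differentiable F t &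
            \forall w' \near w, h w' = F (uv (val w'))]
  end.

Definition fibre_product (R : realType) (k : category) (X M N : catSpace R k)
    (f : M -> X) (g : N -> X) : catSpace R k :=
  let A := [set w : M * N | f w.1 = g w.2] in
  @CatSpace R k (set_type A) (product_funs A (funs M) (funs N)).

Section OrbitSpace.
Local Open Scope quotient_scope.
Context {R : realType} {k : category} (Z : catSpace R k).
Context (I : Type) (a : I -> Z -> Z).

Definition orbit_of (z : Z) : set Z := [set a i z | i in [set: I]].

Definition same_orbit (z z' : Z) : bool := `[< orbit_of z = orbit_of z' >].

Lemma same_orbit_equiv : equiv_class_of same_orbit.
Proof.
split=> [z|z z'|z' z z''].
- by apply/asboolP.
- by apply/asboolP/asboolP.
- by move=> /asboolP h1 /asboolP h2; apply/asboolP; rewrite h1.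
Qed.

Definition orbit_equiv := EquivRelPack same_orbit_equiv.

Definition orbits : topologicalType := quotient_topology {eq_quot orbit_equiv}.

Definition orbit_class (z : Z) : orbits := \pi_({eq_quot orbit_equiv}) z.

Definition orbit_repr (c : orbits) : Z := repr (c : {eq_quot orbit_equiv}).

End OrbitSpace.

Definition orbit_funs (R : realType) (k : category) (M Q : Type) (r : M -> Q) :
    structure R k M -> structure R k Q :=
  match k with
  | Top => fun _ => tt
  | Hol => fun OM c h => forall z, r z = c -> OM z (h \o r)
  end.

(* The quotient of Z by the action [a], with the quotient topology and with
   structure sheaf the functions which become holomorphic on Z. *)
Definition orbit_space (R : realType) (k : category) (Z : catSpace R k)
    (I : Type) (a : I -> Z -> Z) : catSpace R k :=
  @CatSpace R k (orbits a) (orbit_funs (@orbit_class _ _ _ _ a) (funs Z)).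

(** * Group spaces and torsors *)

Section Torsors.
Context {R : realType} {k : category}.

(* Multiplication is only meaningful on the fibre product over X; it is a total
   function here, with irrelevant values on pairs (a, b) with different
   projections. The same convention is used for actions below. *)
Record group_data (X : catSpace R k) := GroupData {
  gtot :> catSpace R k ;
  gproj : gtot -> X ;
  gmul : gtot -> gtot -> gtot ;
  ginv : gtot -> gtot ;
  gone : X -> gtot ;
  gproj_one : forall x, gproj (gone x) = x
}.

Record is_group_space (X : catSpace R k) (G : group_data X) : Prop := {
  group_tot_space : is_space G ;
  group_proj_morphism : morphism (@gproj X G) ;
  group_proj_submersive : submersive (@gproj X G) ;
  group_mul_morphism :
    morphism (fun w : fibre_product (@gproj X G) (@gproj X G) =>
                gmul (val w).1 (val w).2) ;
  group_inv_morphism : morphism (@ginv X G) ;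
  group_one_morphism : morphism (@gone X G) ;
  group_proj_mul : forall a b : G,
    gproj a = gproj b -> gproj (gmul a b) = gproj a ;
  group_proj_inv : forall a : G, gproj (ginv a) = gproj a ;
  group_mulA : forall a b c : G, gproj a = gproj b -> gproj b = gproj c ->
    gmul a (gmul b c) = gmul (gmul a b) c ;
  group_mul1 : forall a : G, gmul (gone G (gproj a)) a = a ;
  group_mulr1 : forall a : G, gmul a (gone G (gproj a)) = a ;
  group_mulV : forall a : G, gmul (ginv a) a = gone G (gproj a) ;
  group_mulrV : forall a : G, gmul a (ginv a) = gone G (gproj a)
}.

Record right_data (X : catSpace R k) (G : group_data X) := RightData {
  rtot :> catSpace R k ;
  rproj : rtot -> X ;
  ract : rtot -> G -> rtot
}.

Record is_right_space (X : catSpace R k) (G : group_data X) (P : right_data G) :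
    Prop := {
  right_tot_space : is_space P ;
  right_proj_morphism : morphism (@rproj X G P) ;
  right_act_morphism :
    morphism (fun w : fibre_product (@rproj X G P) (@gproj X G) =>
                ract (val w).1 (val w).2) ;
  right_proj_act : forall (z : P) (g : G),
    rproj z = gproj g -> rproj (ract z g) = rproj z ;
  right_act1 : forall z : P, ract z (gone G (rproj z)) = z ;
  right_actM : forall (z : P) (g h : G), rproj z = gproj g -> gproj g = gproj h ->
    ract z (gmul g h) = ract (ract z g) h
}.

Definition right_translations (X : catSpace R k) (G : group_data X) : right_data G :=
  @RightData X G G (@gproj X G) (@gmul X G).

(* P|_U and P'|_U are isomorphic as right G|_U-spaces. *)
Definition right_iso_on (X : catSpace R k) (G : group_data X) (U : set X)
    (P P' : right_data G) : Prop :=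
  exists (phi : P -> P') (phi' : P' -> P),
    [/\ iso_on [set z | U (rproj z)] [set z | U (rproj z)] phi phi',
        forall z, U (rproj z) -> rproj (phi z) = rproj z &
        forall (z : P) (g : G), U (rproj z) -> rproj z = gproj g ->
          phi (ract z g) = ract (phi z) g].

Definition right_iso (X : catSpace R k) (G : group_data X) (P P' : right_data G) :
    Prop := right_iso_on [set: X] P P'.

Definition is_torsor (X : catSpace R k) (G : group_data X) (P : right_data G) : Prop :=
  is_right_space P /\
  forall x : X, exists U : set X,
    [/\ open U, U x & right_iso_on U (right_translations G) P].

Definition trivial_torsor (X : catSpace R k) (G : group_data X) (P : right_data G) :
    Prop := right_iso P (right_translations G).

End Torsors.

(** * Galois covers *)

Section Galois.
Context {R : realType} {k : category} {X Y : catSpace R k} (q : Y -> X).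

Definition covering : Prop :=
  morphism q /\
  forall x : X, exists (U : set X) (I : Type) (V : I -> set Y) (s : I -> X -> Y),
    [/\ open U /\ U x, forall i, open (V i), trivIset [set: I] V,
        q @^-1` U = \bigcup_i V i & forall i, iso_on (V i) U q (s i)].

(* The group pi = Aut_X(Y). *)
Record deck := Deck {
  dfun :> Y -> Y ;
  dinv : Y -> Y ;
  dfun_morphism : morphism dfun ;
  dinv_morphism : morphism dinv ;
  dfunK : cancel dfun dinv ;
  dinvK : cancel dinv dfun ;
  dfun_over : forall y, q (dfun y) = q y
}.

Lemma id_morphism (Z : catSpace R k) : morphism (@id Z).
Proof.
move=> x; split; first exact: cvg_id.
by case: k Z x => [|] Z x //= h.
Qed.

Lemma comp_morphism (Z1 Z2 Z3 : catSpace R k) (g : Z2 -> Z3) (f : Z1 -> Z2) :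
  morphism g -> morphism f -> morphism (g \o f).
Proof.
move=> mg mf x; have [cf pf] := mf x; have [cg pg] := mg (f x); split.
  exact: continuous_comp.
by case: k Z1 Z2 Z3 g f mg mf x cf pf cg pg => //= ? ? ? g f _ _ x _ pf _ pg h /pg /pf.
Qed.

Definition deck_id : deck :=
  @Deck id id (@id_morphism Y) (@id_morphism Y)
    (fun=> erefl) (fun=> erefl) (fun=> erefl).

Definition deck_comp (f1 f2 : deck) : deck :=
  @Deck (f1 \o f2) (dinv f2 \o dinv f1)
    (comp_morphism (dfun_morphism f1) (dfun_morphism f2))
    (comp_morphism (dinv_morphism f2) (dinv_morphism f1))
    (can_comp (dfunK f1) (dfunK f2)) (can_comp (dinvK f2) (dinvK f1))
    (fun y => etrans (dfun_over f1 (f2 y)) (dfun_over f2 y)).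

Lemma dinv_over (f : deck) y : q (dinv f y) = q y.
Proof. by rewrite -(dfun_over f) dinvK. Qed.

Definition deck_inv (f : deck) : deck :=
  @Deck (dinv f) f (dinv_morphism f) (dfun_morphism f) (dinvK f) (dfunK f)
    (dinv_over f).

Definition left_action (Z : catSpace R k) (a : deck -> Z -> Z) : Prop :=
  [/\ forall f, morphism (a f), forall z, a deck_id z = z &
      forall f1 f2 z, a (deck_comp f1 f2) z = a f1 (a f2 z)].

Definition galois_cover : Prop :=
  [/\ covering, connected [set: Y] &
      isomorphism (fun c : orbit_space dfun => q (orbit_repr c))].

End Galois.

(** * Pullback to the cover, crossed morphisms and twisted quotients *)

Section Pullback.
Context {R : realType} {k : category} {X Y : catSpace R k}.
Context (G : group_data X) (q : Y -> X).

Lemma pullback_one_subproof (y : Y) :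
  (y, gone G (q y)) \in [set w : Y * G | q w.1 = gproj w.2].
Proof. by apply/mem_set => /=; rewrite gproj_one. Qed.

(* [insubd w z] is [z] seen in the fibre product; its default value [w] is used
   only if [z] is not in the fibre product, which does not happen when G is a
   group space and the factors are composable. *)
Definition pullback_group : group_data Y :=
  @GroupData R k Y (fibre_product q (@gproj _ _ _ G))
    (fun w => (val w).1)
    (fun w w' => insubd w ((val w).1, gmul (val w).2 (val w').2))
    (fun w => insubd w ((val w).1, ginv (val w).2))
    (fun y => exist _ (y, gone G (q y)) (pullback_one_subproof y))
    (fun=> erefl).

Definition pullback_right (P : right_data G) : right_data pullback_group :=
  @RightData R k Y pullback_group (fibre_product q (@rproj _ _ _ _ P))
    (fun w => (val w).1)
    (fun w g => insubd w ((val w).1, ract (val w).2 (val g).2)).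

Local Notation Ghat := pullback_group.

Definition tau (f : deck q) (w : Ghat) : Ghat :=
  insubd w (f (val w).1, (val w).2).

Definition is_section (alpha : Y -> Ghat) : Prop :=
  morphism alpha /\ forall y, gproj (alpha y) = y.

Definition section_mul (alpha beta : Y -> Ghat) : Y -> Ghat :=
  fun y => gmul (alpha y) (beta y).

Definition section_inv (alpha : Y -> Ghat) : Y -> Ghat :=
  fun y => ginv (alpha y).

Definition section_act (alpha : Y -> Ghat) (f : deck q) : Y -> Ghat :=
  tau (deck_inv f) \o alpha \o f.

Definition crossed_morphism (psi : deck q -> Y -> Ghat) : Prop :=
  (forall f, is_section (psi f)) /\
  forall f1 f2, psi (deck_comp f1 f2) =
    section_mul (section_act (psi f1) f2) (psi f2).

Definition bullet (alpha : Y -> Ghat) (psi : deck q -> Y -> Ghat) :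
    deck q -> Y -> Ghat :=
  fun f => section_mul (section_mul (section_act alpha f) (psi f))
                       (section_inv alpha).

Definition conjugate (psi psi' : deck q -> Y -> Ghat) : Prop :=
  exists2 alpha, is_section alpha & psi' = bullet alpha psi.

Definition sigma (psi : deck q -> Y -> Ghat) (f : deck q) (w : Ghat) : Ghat :=
  tau f (gmul (psi f (gproj w)) w).

(* The quotient of Ghat by sigma, with [h] . g = [h (y, g)] for h in Ghat_y and
   g in G_q(y); here (y, g) is a representative of g in the quotient of Ghat by
   tau, which is G. *)
Definition twisted_quotient (psi : deck q -> Y -> Ghat) : right_data G :=
  @RightData R k X G (orbit_space (sigma psi))
    (fun c => q (gproj (orbit_repr c : Ghat)))
    (fun c g => let h : Ghat := orbit_repr c in
       orbit_class (sigma psi) (gmul h (insubd h (gproj h, g)))).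

Definition trivialized_torsor (P : right_data G) : Prop :=
  is_torsor P /\ trivial_torsor (pullback_right P).

(* The elements of H^1 are the conjugacy classes in Z^1. *)
Definition cohomology_class (psi : deck q -> Y -> Ghat) :
    (deck q -> Y -> Ghat) -> Prop :=
  fun psi' => crossed_morphism psi' /\ conjugate psi psi'.

Definition H1 (C : (deck q -> Y -> Ghat) -> Prop) : Prop :=
  exists2 psi, crossed_morphism psi & C = cohomology_class psi.

Definition iso_class (P : right_data G) : right_data G -> Prop :=
  fun P' => trivialized_torsor P' /\ right_iso P P'.

Definition trivialized_iso_class (C : right_data G -> Prop) : Prop :=
  exists2 P, trivialized_torsor P & C = iso_class P.

End Pullback.

(* [set_bij] cannot be used for isomorphism classes: [right_data G] lives in a
   universe above the one over which [set] ranges. *)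
Definition bijective_between (T U : Type) (A : T -> Prop) (B : U -> Prop)
    (F : T -> U) : Prop :=
  [/\ forall x, A x -> B (F x),
      forall x x', A x -> A x' -> F x = F x' -> x = x' &
      forall y, B y -> exists2 x, A x & F x = y].

(* Main.v *)
Require Import Defs.
From mathcomp Require Import all_boot all_order all_algebra.
From mathcomp Require Import all_classical all_reals all_analysis.

Set Implicit Arguments.
Unset Strict Implicit.
Unset Printing Implicit Defensive.

Import Order.TTheory GRing.Theory Num.Theory.
Import numFieldNormedType.Exports.
Local Open Scope classical_set_scope.
Local Open Scope ring_scope.

(** The theorem is descent along the Galois cover [q].

    A crossed morphism [psi] is best read through its components
    c_f(y) = [cocycle psi f y] in the fibre of G over q(y).  In these terms
    sigma_f (y, g) = (f y, c_f(y) g), and the crossed identity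
    c_(f1 f2)(y) = c_f1(f2 y) c_f2(y) says that sigma is a left action; it
    commutes with right translations by associativity.  The deck group acts
    transitively on the fibres of [q], and freely because Y is connected.  Hence
    an orbit of sigma has exactly one representative over each y above its
    image in X ([twisted_class_over], [twisted_class_inj]).  As a function of y
    and of the orbit, this representative [twisted_lift] is a morphism:
    along a local section of [q], its composite with the orbit map is, near any
    point, a single sigma_f ([twisted_lift_morphism_at]).  It provides the local trivialisations of
    the quotient as well as the trivialisation of its pullback to Y.

    In the other direction, a trivialisation of q^*P amounts to an equivariant
    morphism b from q^*G to P over X such that the map w |-> (y, b w), for w over
    y, has an inverse morphism ([framing]).  The elements c_f(y) determined by
    b (f y, c_f(y)) = b (y, 1) form a crossed morphism for which b is invariant
    under sigma ([framing_twist]), and an invariant framing descends to an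
    isomorphism from the quotient to P ([twisted_quotient_iso]).  A section alpha
    changes a framing b into w |-> b (alpha(y) w) ([framing_gauge]); this changes
    the crossed morphism by conjugation.  Every isomorphism between two quotients
    arises in this way, alpha(y) being the representative over y of the image of
    the class of (y, 1) ([twisted_iso_conjugate]).

    None of this depends on the category once morphisms can be composed, compared
    locally and paired into fibre products.  In the holomorphic case, pairing
    requires that the functions on the source be stable under holomorphic
    functions of several variables; this is [has_functional_calculus], which
    holds for manifolds and for fibre products, and passes to orbit spaces.
    That the quotients are manifolds follows from their being locally over X
    isomorphic to G, with X and G Hausdorff ([locally_iso_space]). *)

(** * Composition of holomorphic functions *)

Lemma differentiable_row (K : numFieldType) (V : normedModType K) (n : nat)
    (f : 'I_n -> V -> K) (x : V) :
  (forall i, differentiable (f i) x) ->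
  differentiable (fun z => \row_i f i z : 'rV[K]_n) x.
Proof.
move=> df.
have -> : (fun z => \row_i f i z : 'rV[K]_n) =
    \sum_(i < n) (fun z => f i z *: delta_mx 0 i : 'rV[K]_n).
  apply/funext => z; rewrite fct_sumE [LHS]row_sum_delta.
  by apply: eq_bigr => i _; rewrite mxE.
by apply: differentiable_sum => i; exact: differentiableZl.
Qed.

(** Composition of germs of holomorphic functions of several variables: the value
    of [F] away from the image of the centre is irrelevant, so that everything is
    required only near the points at hand. *)
Lemma differentiable_comp_row (K : numFieldType) (V : normedModType K) (n : nat)
    (f : 'I_n -> V -> K) (F : 'rV[K]_n -> K) (x : V) :
  (forall i, \forall z \near x, differentiable (f i) z) ->
  (\forall t \near \row_i f i x, differentiable F t) ->
  \forall z \near x, differentiable (fun z => F (\row_i f i z)) z.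
Proof.
move=> df dF.
have dr : \forall z \near x, differentiable (fun z => \row_i f i z : 'rV[K]_n) z.
  have : \forall z \near x, forall i, differentiable (f i) z.
    exact: filter_forall.
  by apply: filterS => z; exact: differentiable_row.
have cr : {for x, continuous (fun z => \row_i f i z : 'rV[K]_n)}.
  exact/differentiable_continuous/(nbhs_singleton dr).
near=> z; apply: (@differentiable_comp _ _ _ _ _ F).
  by near: z.
near: z; exact: cr _ dF.
Unshelve. all: by end_near. Qed.

Lemma near_differentiable_coord (K : numFieldType) n (j : 'I_n) (x : 'rV[K]_n) :
  \forall t \near x, differentiable (fun t : 'rV[K]_n => t 0 j : K) t.
Proof. by near=> t; exact: differentiable_coord. Unshelve. all: by end_near. Qed.

Definition funs_composable (R : realType) (M : catSpace R Hol) : Prop :=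
  forall (x : M) n (u : 'I_n -> M -> Cplx R) (F : 'rV[Cplx R]_n -> Cplx R),
    (forall i, funs M x (u i)) ->
    (\forall t \near \row_i u i x, differentiable F t) ->
    funs M x (fun z => F (\row_i u i z)).

(** What pairing of morphisms needs from the structure sheaf of the source.  The
    orbit spaces below satisfy this before they are known to be manifolds. *)
Definition has_functional_calculus (R : realType) (k : category) :
    catSpace R k -> Prop :=
  match k with
  | Top => fun _ => True
  | Hol => fun M => funs_local M /\ funs_composable M
  end.

Section Morphisms.
Context {R : realType} {k : category}.
Implicit Types X Y Z M N : catSpace R k.

Lemma morphism_at_comp X Y Z (g : Y -> Z) (f : X -> Y) x :
  morphism_at g (f x) -> morphism_at f x -> morphism_at (g \o f) x.
Proof.
move=> [cg pg] [cf pf]; split; first exact: continuous_comp.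
by case: k X Y Z g f x cg pg cf pf => //= X Y Z g f x _ pg _ pf h /pg /pf.
Qed.

(** Being a morphism at a point depends only on the germ there. *)
Lemma morphism_at_near X Y (f f' : X -> Y) x : has_functional_calculus X ->
  (\forall z \near x, f z = f' z) -> morphism_at f x -> morphism_at f' x.
Proof.
move=> rX e [cf pf]; have ex := nbhs_singleton e; split.
  move=> A; rewrite -ex => /cf; rewrite /= !nbhs_simpl /=.
  by apply: filterS2 e => z /= ->.
case: k X Y f f' x rX e {cf} pf ex => //= X Y f f' x [loc _] e pf ex h hh.
apply: (loc _ (h \o f)); first by apply: filterS e => z /= ->.
by apply: pf; rewrite ex.
Qed.

End Morphisms.

Section Manifolds.
Context {R : realType}.

(** In a chart, functions are holomorphic functions on an open subset of C^n, where
    composition is possible; the chart then carries the composite back. *)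
Lemma manifold_calculus (M : catSpace R Hol) :
  is_manifold M -> has_functional_calculus M.
Proof.
move=> [_ loc charts]; split=> // x m u F hu hF.
have [n [phi [phi' [U [V [oU oV Ux [mphi mphi' cU cV]]]]]]] := charts x.
have [Vx xK] := cU x Ux.
have [_ pphi] := mphi x Ux.
have [_ pphi'] := mphi' _ Vx.
apply: (loc x ((fun t => F (\row_i u i (phi' t))) \o phi)).
  apply: filterS (open_nbhs_nbhs (conj oU Ux)) => z Uz /=.
  by have [_ ->] := cU z Uz.
apply: pphi; apply: differentiable_comp_row; last by rewrite xK.
by move=> i; apply: pphi'; rewrite xK.
Qed.

End Manifolds.

(** * Fibre products *)

Section FibreProducts.

(** Finitely many functions on a fibre product can be expressed through the same
    coordinates: collect those used by the individual functions, indexed by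
    disjoint unions. *)
Lemma product_funs_family (R : realType) (M N : topologicalType) (A : set (M * N))
    (OM : structure R Hol M) (ON : structure R Hol N) (w : A) p
    (h : 'I_p -> A -> Cplx R) :
  (forall i, product_funs A OM ON w (h i)) ->
  exists m n (u : 'I_m -> M -> Cplx R) (v : 'I_n -> N -> Cplx R)
      (F : 'I_p -> 'rV[Cplx R]_(m + n) -> Cplx R),
    let uv (z : M * N) := row_mx (\row_i u i z.1) (\row_j v j z.2) in
    [/\ forall i, OM (val w).1 (u i), forall j, ON (val w).2 (v j),
        forall i, \forall t \near uv (val w), differentiable (F i) t &
        \forall w' \near w, forall i, h i w' = F i (uv (val w'))].
Proof.
move=> /choice[m /choice[n hn]].
have [u hu] := all_sig (fun i => cid (hn i)).
have [v hv] := all_sig (fun i => cid (hu i)).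
have [F hF] := all_sig (fun i => cid (hv i)).
rewrite /= in hF; clear hn hu hv.
pose I := {i : 'I_p & 'I_(m i)}; pose J := {i : 'I_p & 'I_(n i)}.
(* Position, among all the collected coordinates, of the c-th one used by h i. *)
pose sel i (c : 'I_(m i + n i)) : 'I_(#|{: I}| + #|{: J}|) :=
  match fintype.split c with
  | inl a => lshift _ (enum_rank (Tagged (fun i => 'I_(m i)) a))
  | inr b => rshift _ (enum_rank (Tagged (fun i => 'I_(n i)) b))
  end.
pose U (a : 'I_#|{: I}|) := u (tag (enum_val a)) (tagged (enum_val a)).
pose V (b : 'I_#|{: J}|) := v (tag (enum_val b)) (tagged (enum_val b)).
have selE i z :
    \row_c (row_mx (\row_a U a z.1) (\row_b V b z.2) : 'rV[Cplx R]__) 0 (sel i c) =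
    row_mx (\row_a u i a z.1) (\row_b v i b z.2).
  apply/rowP => c; rewrite mxE /sel.
  case: fintype.split_ordP => a ->; rewrite ?row_mxEl ?row_mxEr !mxE /U /V.
    by rewrite enum_rankK.
  by rewrite enum_rankK.
exists #|{: I}|, #|{: J}|, U, V, (fun i t => F i (\row_c t 0 (sel i c))) => /=.
split=> [a|b|i|].
- by have [ha _ _ _] := hF (tag (enum_val a)); exact: ha.
- by have [_ hb _ _] := hF (tag (enum_val b)); exact: hb.
- have [_ _ dF _] := hF i.
  apply: (@differentiable_comp_row _ _ _ (fun c (t : 'rV[Cplx R]__) => t 0 (sel i c))).
    by move=> c; exact: near_differentiable_coord.
  by rewrite selE.
- apply: (filter_forall (nbhs_filter w)) => i; have [_ _ _ e] := hF i.
  by apply: filterS e => w' ->; rewrite selE.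
Qed.

Lemma fibre_product_calculus (R : realType) (k : category) (X M N : catSpace R k)
    (f : M -> X) (g : N -> X) : has_functional_calculus (fibre_product f g).
Proof.
case: k X M N f g => [//|] X M N f g; split=> [w h h' e|w p h F hh dF].
  move=> [m [n [u [v [F [hu hv dF hF]]]]]]; exists m, n, u, v, F; split=> //.
  by apply: filterS2 e hF => z ->.
have [m [n [u [v [H [hu hv dH hH]]]]]] := product_funs_family hh.
exists m, n, u, v, (fun t => F (\row_i H i t)); split; [exact: hu|exact: hv| |].
  apply: differentiable_comp_row; first exact: dH.
  have -> : \row_i H i (row_mx (\row_i u i (val w).1) (\row_j v j (val w).2)) =
      \row_i h i w; last by [].
  by apply/rowP => i; rewrite !mxE (nbhs_singleton hH).
apply: (filterS _ hH) => w' e.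
by congr F; apply/rowP => i; rewrite !mxE.
Qed.

Context {R : realType} {k : category}.
Implicit Types X Y Z M N : catSpace R k.

Lemma fibre_fst_morphism X M N (f : M -> X) (g : N -> X) :
  morphism (fun w : fibre_product f g => (val w).1).
Proof.
move=> w; split.
  apply: continuous_comp; first exact: initial_continuous.
  exact: cvg_fst.
case: k X M N f g w => [//|] X M N f g w h hh.
exists 1%N, 0%N, (fun=> h), (fun _ _ => 0 : Cplx R),
  (fun t : 'rV[Cplx R]__ => t 0 (lshift _ 0)).
split=> //.
- by case.
- exact: near_differentiable_coord.
- by apply: (filterE (nbhs_filter w)) => z; rewrite row_mxEl mxE.
Qed.

Lemma fibre_snd_morphism X M N (f : M -> X) (g : N -> X) :
  morphism (fun w : fibre_product f g => (val w).2).
Proof.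
move=> w; split.
  apply: continuous_comp; first exact: initial_continuous.
  exact: cvg_snd.
case: k X M N f g w => [//|] X M N f g w h hh.
exists 0%N, 1%N, (fun _ _ => 0 : Cplx R), (fun=> h),
  (fun t : 'rV[Cplx R]__ => t 0 (rshift _ 0)).
split=> //.
- by case.
- exact: near_differentiable_coord.
- by apply: (filterE (nbhs_filter w)) => z; rewrite row_mxEr mxE.
Qed.

(** The universal property of the fibre product.  A function on it is F(u, v) with
    u and v functions on the factors; it pulls back to the composite of F with
    the pullbacks of u and v. *)
Lemma fibre_pair_morphism_at X M N Z (f : M -> X) (g : N -> X)
    (e : Z -> fibre_product f g) (z : Z) : has_functional_calculus Z ->
  morphism_at (fun z => (val (e z)).1) z ->
  morphism_at (fun z => (val (e z)).2) z -> morphism_at e z.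
Proof.
move=> rZ [c1 p1] [c2 p2].
have ce : {for z, continuous e}.
  move=> A [_ [[W oW <-] Wez sWA]]; rewrite /= nbhs_simpl /=.
  have cve : {for z, continuous (fun z' => ((val (e z')).1, (val (e z')).2))}.
    exact: cvg_pair.
  have cW : nbhs z [set z' | W ((val (e z')).1, (val (e z')).2)].
    by apply: cve; rewrite -surjective_pairing; exact: open_nbhs_nbhs.
  apply: (filterS _ cW) => z' /=; rewrite -surjective_pairing.
  exact: sWA.
split=> //.
case: k X M N Z f g e z rZ c1 p1 c2 p2 ce => [//|]
  X M N Z f g e z [loc comp] c1 p1 c2 p2 ce.
move=> h [m [n [u [v [F [hu hv dF hF]]]]]].
pose t c z : Cplx R := match fintype.split c with
  | inl a => u a (val (e z)).1 | inr b => v b (val (e z)).2 end.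
have tE z' : \row_c t c z' =
    row_mx (\row_i u i (val (e z')).1) (\row_j v j (val (e z')).2).
  by apply/rowP => c; rewrite mxE /t; case: fintype.split_ordP => a ->;
    rewrite ?row_mxEl ?row_mxEr mxE.
apply: (loc z (fun z => F (\row_c t c z))).
  have eF := ce _ hF; rewrite /= nbhs_simpl /= in eF.
  by apply: (filterS _ eF) => z' /= ->; rewrite tE.
apply: comp; last by rewrite tE.
move=> c; rewrite /t; case: (fintype.split c) => a; [exact: p1|exact: p2].
Qed.

End FibreProducts.

Lemma space_calculus (R : realType) (k : category) (Z : catSpace R k) :
  is_space Z -> has_functional_calculus Z.
Proof. by case: k Z => [//|] Z; exact: manifold_calculus. Qed.

(** * Orbit spaces of deck group actions *)

Lemma pulls_back_orbit_class (R : realType) (k : category) (M Q : Type) (r : M -> Q)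
    (OM : structure R k M) z : pulls_back OM (orbit_funs r OM) r z.
Proof. by case: k OM => [//|] OM h hh; exact: hh. Qed.

Lemma pulls_back_orbit (R : realType) (k : category) (M Q W : Type) (r : M -> Q)
    (OM : structure R k M) (OW : structure R k W) (f : Q -> W) c :
  (forall z, r z = c -> pulls_back OM OW (f \o r) z) ->
  pulls_back (orbit_funs r OM) OW f c.
Proof. by case: k OM OW => [//|] OM OW fr h hh z rz; apply: fr => //=; rewrite rz. Qed.

(** Functions on an orbit space are defined by pulling back to the total space. *)
Lemma orbit_space_calculus (R : realType) (k : category) (Z : catSpace R k)
    (I : Type) (a : I -> Z -> Z) :
  has_functional_calculus Z -> has_functional_calculus (orbit_space a).
Proof.
case: k Z a => [//|] Z a [loc comp]; split=> [c h h' e hh z zc|c m u F hu dF z zc].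
  apply: (loc z (h \o orbit_class a)); last exact: hh.
  have cz : {for z, continuous (orbit_class a)} by exact: pi_continuous.
  have ez : nbhs (orbit_class a z) [set c | h c = h' c] by rewrite zc.
  exact: (cz _ ez).
by apply: (comp z _ (fun i => u i \o orbit_class a)) => /= [i|]; [exact: hu|rewrite zc].
Qed.

Section OrbitSpaces.
Context {R : realType} {k : category} {X Y : catSpace R k} {q : Y -> X}.

(** The inverse and the proofs carried by a deck transformation are determined by
    the underlying map. *)
Lemma deck_ext (f g : deck q) : f =1 g -> f = g.
Proof.
case: f g => [f f' mf mf' fK f'K fo] [g g' mg mg' gK g'K go] /= /funext efg.
have efg' : f' = g' by apply/funext => y; rewrite -[y in LHS]g'K -efg fK.
case: g / efg mg gK g'K go => mg gK g'K go; case: g' / efg' mg' gK g'K => mg' gK g'K.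
by congr Deck; exact: Prop_irrelevance.
Qed.

Lemma dfun_left_action : left_action (@dfun _ _ _ _ q).
Proof. by split=> // f; exact: dfun_morphism. Qed.

Context {Z : catSpace R k} {a : deck q -> Z -> Z} (la : left_action a).

Lemma deck_actK f : cancel (a f) (a (deck_inv f)).
Proof.
have [_ a1 aM] := la => z; rewrite -aM -[RHS]a1; congr a.
by apply: deck_ext => y /=; rewrite dfunK.
Qed.

Lemma orbit_reprK : cancel (@orbit_repr _ _ _ _ a) (orbit_class a).
Proof. exact: reprK. Qed.

Lemma orbit_class_eq z z' :
  orbit_class a z = orbit_class a z' <-> exists f, a f z = z'.
Proof.
have [_ a1 aM] := la.
have -> : (orbit_class a z = orbit_class a z') <-> orbit_of a z = orbit_of a z'.
  split=> [/eqquotP/asboolP//|e]; apply/eqquotP; exact/asboolP.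
split=> [e|[f <-]].
  have [f _ fz] : orbit_of a z z' by rewrite e; exists (deck_id q); last exact: a1.
  by exists f.
apply/seteqP; split=> _ [g _ <-].
  by exists (deck_comp g (deck_inv f)) => //; rewrite aM deck_actK.
by exists (deck_comp g f) => //; rewrite aM.
Qed.

Lemma orbit_class_act f z : orbit_class a (a f z) = orbit_class a z.
Proof. by apply/esym/orbit_class_eq; exists f. Qed.

Lemma orbit_class_morphism : morphism (orbit_class a : Z -> orbit_space a).
Proof.
move=> z; split; first exact: pi_continuous.
exact: pulls_back_orbit_class.
Qed.

(** The quotient map is open: the saturation of an open set is the union of its
    translates. *)
Lemma orbit_class_nbhs (z : Z) (A : set (orbit_space a)) :
  nbhs z (orbit_class a @^-1` A) -> nbhs (orbit_class a z) A.
Proof.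
have [ma _ _] := la.
rewrite nbhsE => -[B [oB Bz] sBA].
apply: (@filterS _ _ (nbhs_filter _) (orbit_class a @` B)).
  by move=> _ [z' Bz' <-]; exact: sBA.
apply: open_nbhs_nbhs; split; last by exists z.
rewrite /open /= /quotient_open.
have -> : orbit_class a @^-1` (orbit_class a @` B) = \bigcup_f (a f @^-1` B).
  apply/seteqP; split=> [z' [z'' Bz'' /esym/orbit_class_eq[f fz]]|z' [f _ Bfz]].
    by exists f => //=; rewrite fz.
  by exists (a f z') => //; exact: orbit_class_act.
apply: bigcup_open => f _; apply: open_comp => // z' _; exact: (ma f z').1.
Qed.

(** Morphisms out of an orbit space are the invariant morphisms on the total
    space.  One representative [z] is enough, because the action carries it to the
    others by automorphisms. *)
Lemma orbit_morphism_at (W : catSpace R k) (f : orbit_space a -> W) z :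
  morphism_at (fun z => f (orbit_class a z)) z -> morphism_at f (orbit_class a z).
Proof.
move=> mf; split.
  move=> A /(mf.1); rewrite /= !nbhs_simpl /= => h; exact: orbit_class_nbhs.
have {}mf z' : orbit_class a z' = orbit_class a z ->
    morphism_at (fun z => f (orbit_class a z)) z'.
  move=> /orbit_class_eq[g gz]; rewrite -gz in mf.
  have [ma _ _] := la.
  have := morphism_at_comp mf (ma g z').
  by congr morphism_at; apply/funext => z'' /=; rewrite orbit_class_act.
by apply: pulls_back_orbit => z' /mf[].
Qed.

End OrbitSpaces.

(** * Galois covers *)

Section GaloisCovers.
Context {R : realType} {k : category} {X Y : catSpace R k} {q : Y -> X}.

Lemma near_preimage (Z W : catSpace R k) (f : Z -> W) (A : set W) z :
  morphism_at f z -> open A -> A (f z) -> \forall z' \near z, A (f z').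
Proof. by move=> [cf _] oA Afz; apply: cf; exact: open_nbhs_nbhs. Qed.

Lemma covering_local_section y : covering q ->
  exists (U : set X) (V : set Y) (s : X -> Y),
    [/\ open U, open V, V y & iso_on V U q s].
Proof.
move=> [_ /(_ (q y))[U [I [V [s [[oU Uy] oV _ qU iV]]]]]].
have [i _ Vy] : (\bigcup_i V i) y by rewrite -qU.
by exists U, (V i), (s i); split.
Qed.

(** The set where [f] and [g] agree is open, since [q] is injective on a sheet, and
    closed, since distinct points of a fibre of [q] are separated by disjoint
    sheets or by injectivity on one sheet. *)
Lemma deck_free (f g : deck q) y : covering q -> connected [set: Y] ->
  f y = g y -> f = g.
Proof.
move=> cq cY fgy.
suff E : [set y | f y = g y] = setT.
  by apply: deck_ext => z; have : [set: Y] z by []; rewrite -E.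
apply: cY; first by exists y.
- exists [set y | f y = g y]; last by rewrite setTI.
  rewrite openE => z /= fgz.
  have [U [V [s [_ oV Vz [_ _ sK _]]]]] := covering_local_section (f z) cq.
  have nf := near_preimage (dfun_morphism f z) oV Vz.
  rewrite fgz in Vz.
  have ng := near_preimage (dfun_morphism g z) oV Vz.
  apply: filterS2 nf ng => z' Vf Vg.
  by rewrite /= -(sK _ Vf).2 -(sK _ Vg).2 !dfun_over.
- exists [set y | f y = g y]; last by rewrite setTI.
  rewrite -openC openE => z /= fgz.
  have [_ /(_ (q z))[U [I [V [s [[_ Uz] oV tV qU iV]]]]]] := cq.
  have [i _ Vf] : (\bigcup_i V i) (f z) by rewrite -qU /= dfun_over.
  have [j _ Vg] : (\bigcup_i V i) (g z) by rewrite -qU /= dfun_over.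
  have nf := near_preimage (dfun_morphism f z) (oV i) Vf.
  have ng := near_preimage (dfun_morphism g z) (oV j) Vg.
  apply: filterS2 nf ng => z' Vf' Vg' /= fgz'; apply: fgz.
  have ij : i = j.
    by apply: tV => //; exists (f z'); split=> //; rewrite fgz'.
  move: Vf Vg; rewrite -{}ij => Vf Vg.
  have [_ _ sK _] := iV i.
  by rewrite -(sK _ Vf).2 -(sK _ Vg).2 !dfun_over.
Qed.

Context (hq : galois_cover q).

(** Points of one fibre of [q] have the same image in the orbit space of the deck
    group, because that orbit space is isomorphic to X. *)
Lemma deck_transitive y y' : q y = q y' -> exists f : deck q, f y = y'.
Proof.
have [_ _ [g [_ _ gK _]]] := hq => qyy'.
have qrepr (z : Y) : q (orbit_repr (orbit_class (@dfun _ _ _ _ q) z)) = q z.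
  have /esym := orbit_reprK (orbit_class (@dfun _ _ _ _ q) z).
  by move=> /(orbit_class_eq dfun_left_action)[f <-]; rewrite dfun_over.
apply/(orbit_class_eq dfun_left_action).
by rewrite -(gK (orbit_class _ y)) qrepr qyy' -qrepr gK.
Qed.

Lemma galois_surjective : exists s : X -> Y, cancel s q.
Proof.
by have [_ _ [g [_ _ _ qK]]] := hq; exists (fun x => orbit_repr (g x)).
Qed.

End GaloisCovers.

(** * Points of fibre products and the group law in coordinates *)

Section FibreProductPoints.
Context {R : realType} {k : category} {X M N : catSpace R k}.
Context {f : M -> X} {g : N -> X}.

Lemma fibre_productP (w : fibre_product f g) : f (val w).1 = g (val w).2.
Proof. exact: (set_mem (valP w)). Qed.

Lemma fibre_product_ext (w w' : fibre_product f g) :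
  (val w).1 = (val w').1 -> (val w).2 = (val w').2 -> w = w'.
Proof. by move=> e1 e2; apply/val_inj/eqP; rewrite -pair_eqE /= e1 e2 !eqxx. Qed.

Definition fibre_pair m n (e : f m = g n) : fibre_product f g :=
  exist _ (m, n) (mem_set e).

Lemma fibre_insubdK (w : fibre_product f g) m n :
  f m = g n -> val (insubd w (m, n)) = (m, n).
Proof. by move=> e; apply: insubdK; apply/mem_set. Qed.

(** Pairing of maps that are compatible only near [z], as local sections are.  The
    default value [w] of [insubd] is taken only away from [z]. *)
Lemma fibre_insubd_morphism_at (Z : catSpace R k) (w : fibre_product f g)
    (a : Z -> M) (b : Z -> N) z :
  has_functional_calculus Z -> (\forall z' \near z, f (a z') = g (b z')) ->
  morphism_at a z -> morphism_at b z ->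
  morphism_at (fun z => insubd w (a z, b z) : fibre_product f g) z.
Proof.
move=> rZ eab ma mb.
have eE : \forall z' \near z, val (insubd w (a z', b z')) = (a z', b z').
  by apply: filterS eab => z'; exact: fibre_insubdK.
apply: fibre_pair_morphism_at => //.
  by apply: (morphism_at_near rZ _ ma); apply: filterS eE => z' ->.
by apply: (morphism_at_near rZ _ mb); apply: filterS eE => z' ->.
Qed.

Lemma fibre_comp_morphism_at (Z W : catSpace R k) (h : M -> N -> W)
    (a : Z -> M) (b : Z -> N) z :
  morphism (fun w : fibre_product f g => h (val w).1 (val w).2) ->
  has_functional_calculus Z -> (\forall z' \near z, f (a z') = g (b z')) ->
  morphism_at a z -> morphism_at b z -> morphism_at (fun z => h (a z) (b z)) z.
Proof.
move=> mh rZ eab ma mb; have eab0 := nbhs_singleton eab.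
have me := fibre_insubd_morphism_at (fibre_pair eab0) rZ eab ma mb.
apply: (morphism_at_near rZ _ (morphism_at_comp (mh _) me)).
by apply: filterS eab => z' /= e; rewrite fibre_insubdK.
Qed.

End FibreProductPoints.

Section GroupSpaces.
Context {R : realType} {k : category} {X : catSpace R k} {G : group_data X}.
Context (hG : is_group_space G).

Lemma gmul_morphism_at (Z : catSpace R k) (a b : Z -> G) z :
  has_functional_calculus Z ->
  (\forall z' \near z, gproj (a z') = gproj (b z')) ->
  morphism_at a z -> morphism_at b z ->
  morphism_at (fun z => gmul (a z) (b z)) z.
Proof. exact/fibre_comp_morphism_at/group_mul_morphism. Qed.

Lemma gmulK (a b : G) : gproj a = gproj b -> gmul (ginv a) (gmul a b) = b.
Proof.
move=> ab; rewrite group_mulA ?group_proj_inv // group_mulV // ab.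
exact: group_mul1.
Qed.

Lemma gmulVK (a b : G) : gproj a = gproj b -> gmul a (gmul (ginv a) b) = b.
Proof.
move=> ab; rewrite group_mulA ?group_proj_inv // group_mulrV // ab.
exact: group_mul1.
Qed.

Lemma gmulI (a b c : G) : gproj a = gproj b -> gproj a = gproj c ->
  gmul a b = gmul a c -> b = c.
Proof. by move=> ab ac e; rewrite -(gmulK ab) e gmulK. Qed.

Lemma gmul_idem (a : G) : gmul a a = a -> a = gone G (gproj a).
Proof.
move=> e; apply: (@gmulI a); rewrite ?gproj_one ?group_mulr1 //.
Qed.

End GroupSpaces.

(** * Sections and crossed morphisms in coordinates *)

Section Pullback.
Context {R : realType} {k : category} {X Y : catSpace R k}.
Context {G : group_data X} {q : Y -> X} (hG : is_group_space G).
Local Notation Ghat := (pullback_group G q).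

Lemma pullback_mulE (w w' : Ghat) : (val w).1 = (val w').1 ->
  val (gmul w w') = ((val w).1, gmul (val w).2 (val w').2).
Proof.
move=> e; apply: fibre_insubdK; rewrite group_proj_mul ?fibre_productP //.
by rewrite -!fibre_productP e.
Qed.

Lemma pullback_invE (w : Ghat) : val (ginv w) = ((val w).1, ginv (val w).2).
Proof. by apply: fibre_insubdK; rewrite group_proj_inv ?fibre_productP. Qed.

Lemma tauE (f : deck q) (w : Ghat) : val (tau f w) = (f (val w).1, (val w).2).
Proof. by apply: fibre_insubdK; rewrite dfun_over fibre_productP. Qed.

Lemma section_proj (alpha : Y -> Ghat) y :
  is_section alpha -> (val (alpha y)).1 = y.
Proof. by move=> [_ /(_ y)]. Qed.

Lemma section_gproj (alpha : Y -> Ghat) y :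
  is_section alpha -> gproj (val (alpha y)).2 = q y.
Proof. by move=> sa; rewrite -fibre_productP section_proj. Qed.

Lemma section_snd_morphism (alpha : Y -> Ghat) :
  is_section alpha -> morphism (fun y => (val (alpha y)).2).
Proof.
by move=> [ma _] y; apply: (morphism_at_comp (fibre_snd_morphism _) (ma y)).
Qed.

Lemma is_section_fibre_pair (a : Y -> G) : has_functional_calculus Y -> morphism a ->
  forall e : (forall y, q y = gproj (a y)),
  is_section (fun y => fibre_pair (e y) : Ghat).
Proof.
move=> rY ma e; split=> // y; apply: fibre_pair_morphism_at => //=; exact: id_morphism.
Qed.

Lemma section_actE (alpha : Y -> Ghat) (f : deck q) y : is_section alpha ->
  val (section_act alpha f y) = (y, (val (alpha (f y))).2).
Proof. by move=> sa; rewrite tauE section_proj // /= dfunK. Qed.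

(** The component of [psi f y] in the fibre of G over [q y]. *)
Definition cocycle (psi : deck q -> Y -> Ghat) f y : G := (val (psi f y)).2.

Lemma cocycle_proj (psi : deck q -> Y -> Ghat) f y : is_section (psi f) ->
  gproj (cocycle psi f y) = q y.
Proof. exact: section_gproj. Qed.

Lemma sigmaE (psi : deck q -> Y -> Ghat) f (w : Ghat) : is_section (psi f) ->
  val (sigma psi f w) =
    (f (val w).1, gmul (cocycle psi f (val w).1) (val w).2).
Proof. by move=> sp; rewrite tauE pullback_mulE section_proj. Qed.

Lemma cocycleM (psi : deck q -> Y -> Ghat) f1 f2 y : crossed_morphism psi ->
  cocycle psi (deck_comp f1 f2) y =
    gmul (cocycle psi f1 (f2 y)) (cocycle psi f2 y).
Proof.
move=> [sp pM]; rewrite /cocycle pM.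
by rewrite pullback_mulE section_actE //= section_proj.
Qed.

Lemma crossed_of_cocycle (c : deck q -> Y -> G) : has_functional_calculus Y ->
  (forall f, morphism (c f)) -> (forall f y, q y = gproj (c f y)) ->
  (forall f1 f2 y, c (deck_comp f1 f2) y = gmul (c f1 (f2 y)) (c f2 y)) ->
  exists2 psi, crossed_morphism psi & forall f y, cocycle psi f y = c f y.
Proof.
move=> rY mc pc cM; exists (fun f y => fibre_pair (pc f y) : Ghat) => //.
have sp f : is_section (fun y => fibre_pair (pc f y) : Ghat).
  exact: is_section_fibre_pair.
split=> // f1 f2; apply/funext => y.
by apply: fibre_product_ext; rewrite pullback_mulE section_actE //= cM.
Qed.

Lemma bulletE (alpha : Y -> Ghat) (psi : deck q -> Y -> Ghat) f y :
  is_section alpha -> is_section (psi f) ->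
  val (bullet alpha psi f y) =
    (y, gmul (gmul (val (alpha (f y))).2 (cocycle psi f y)) (ginv (val (alpha y)).2)).
Proof.
move=> sa sp.
have E1 : val (section_mul (section_act alpha f) (psi f) y) =
    (y, gmul (val (alpha (f y))).2 (cocycle psi f y)).
  by rewrite pullback_mulE section_actE //= section_proj.
by rewrite pullback_mulE E1 ?pullback_invE //= section_proj.
Qed.

(** Conjugation without inverses: c'_f(y) alpha(y) = alpha(f y) c_f(y). *)
Lemma conjugateP (psi psi' : deck q -> Y -> Ghat) :
  crossed_morphism psi -> crossed_morphism psi' ->
  conjugate psi psi' <-> exists2 alpha : Y -> Ghat, is_section alpha &
    forall f y, gmul (cocycle psi' f y) (val (alpha y)).2 =
      gmul (val (alpha (f y))).2 (cocycle psi f y).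
Proof.
move=> [sp _] [sp' _]; split=> -[alpha sa e]; exists alpha => //.
  move=> f y; rewrite {1}/cocycle e bulletE //=.
  have pa : gproj (val (alpha y)).2 = q y by exact: section_gproj.
  have pf : gproj (val (alpha (f y))).2 = q y by rewrite section_gproj ?dfun_over.
  have pc : gproj (cocycle psi f y) = q y by exact: cocycle_proj.
  rewrite -group_mulA ?group_proj_inv ?group_proj_mul ?pa ?pf ?pc //.
  have pm : gproj (gmul (val (alpha (f y))).2 (cocycle psi f y)) = q y.
    by rewrite group_proj_mul ?pf ?pc.
  by rewrite group_mulV // pa -pm group_mulr1.
apply/funext => f; apply/funext => y; apply: fibre_product_ext.
  by rewrite bulletE //= section_proj.
have pa : gproj (val (alpha y)).2 = q y by exact: section_gproj.
have pc : gproj (cocycle psi' f y) = q y by exact: cocycle_proj.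
rewrite bulletE //= -e -group_mulA ?group_proj_inv ?pa ?pc //.
by rewrite group_mulrV // pa -pc group_mulr1.
Qed.

End Pullback.

(** * Spaces locally isomorphic to a manifold *)

Section LocalIsomorphisms.

Lemma open_setI_preimage (S T : topologicalType) (f : S -> T) (A : set S) (B : set T) :
  open A -> open B -> (forall x, A x -> {for x, continuous f}) ->
  open (A `&` f @^-1` B).
Proof.
move=> oA oB cf; rewrite openE => x [Ax Bfx].
have nA : nbhs x A by exact: open_nbhs_nbhs.
have nB : nbhs (f x) B by exact: open_nbhs_nbhs.
by apply: filterS2 nA (cf x Ax _ nB) => z Az Bz; split.
Qed.

(** Transports the Hausdorff property, which is stated through cluster points,
    along maps that are continuous only at the two points concerned. *)
Lemma cluster_image (S T : topologicalType) (f : S -> T) (x y : S) :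
  {for x, continuous f} -> {for y, continuous f} ->
  cluster (nbhs x) y -> cluster (nbhs (f x)) (f y).
Proof.
move=> cx cy xy A B /cx nA /cy nB.
by have [z [Az Bz]] := xy _ _ nA nB; exists (f z).
Qed.

Lemma chart_at_iso (R : realType) (M N : catSpace R Hol) (W : set M) (W' : set N)
    (f : M -> N) (g : N -> M) x n (phi : N -> affine_space R n) phi' :
  open W -> open W' -> W x -> iso_on W W' f g -> chart_at (f x) phi phi' ->
  chart_at x (phi \o f) (g \o phi').
Proof.
move=> oW oW' Wx [mf mg fK gK] [U [V [oU oV Ux [mphi mphi' phiK phi'K]]]].
exists (W `&` f @^-1` U), (V `&` phi' @^-1` W'); split.
- by apply: open_setI_preimage => // z /mf[].
- by apply: open_setI_preimage => // z /mphi'[].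
- by split.
- split.
  + by move=> z [Wz Uz]; apply: morphism_at_comp; [exact: mphi|exact: mf].
  + by move=> t [Vt W't]; apply: morphism_at_comp; [exact: mg|exact: mphi'].
  + move=> z [Wz Uz] /=; have [W'fz gfz] := fK z Wz; have [Vt e] := phiK _ Uz.
    by rewrite /= e; split=> //; split; rewrite //= e.
  + move=> t [Vt W't] /=; have [Ut e] := phi'K _ Vt; have [Wt e'] := gK _ W't.
    by rewrite e' e; split=> //; split=> //=; rewrite e'.
Qed.

(** Charts are transported from G.  Two points of T that cannot be separated have
    the same image in X, hence lie in a common open set isomorphic to a part of G,
    where they coincide. *)
Lemma locally_iso_space (R : realType) (k : category) (X T G : catSpace R k)
    (t : T -> X) (p : G -> X) :
  is_space X -> is_space G -> morphism t -> morphism p -> has_functional_calculus T ->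
  (forall x, exists (U : set X) (f : T -> G) (g : G -> T),
    [/\ open U, U x & iso_on (t @^-1` U) (p @^-1` U) f g]) ->
  is_space T.
Proof.
case: k X T G t p => [//|] X T G t p [hX _ _] [hG _ chG] mt mp [locT _] iT.
split=> // [c c' cc'|c].
  have tcc' : t c = t c' by apply: hX; exact: cluster_image (mt c).1 (mt c').1 cc'.
  have [U [f [g [oU Uc [mf _ fK _]]]]] := iT (t c).
  have Uc' : U (t c') by rewrite -tcc'.
  have fcc' : f c = f c'.
    by apply: hG; exact: cluster_image (mf c Uc).1 (mf c' Uc').1 cc'.
  by rewrite -(fK c Uc).2 fcc' (fK c' Uc').2.
have [U [f [g [oU Uc ifg]]]] := iT (t c).
have [n [phi [phi' ch]]] := chG (f c).
exists n, (phi \o f), (g \o phi'); apply: chart_at_iso ifg ch => //.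
  by apply: open_comp => // z _; exact: (mt z).1.
by apply: open_comp => // z _; exact: (mp z).1.
Qed.

End LocalIsomorphisms.

(** * The quotient by a crossed morphism is a torsor *)

Section TwistedQuotient.
Context {R : realType} {k : category} {X Y : catSpace R k}.
Context {G : group_data X} {q : Y -> X}.
Context (hX : is_space X) (hG : is_group_space G).
Context (hq : galois_cover q).
Local Notation Ghat := (pullback_group G q).
Context {psi : deck q -> Y -> Ghat} (hpsi : crossed_morphism psi).
Local Notation T := (twisted_quotient psi).
Local Notation cl := (orbit_class (sigma psi) : Ghat -> T).

Let rG : has_functional_calculus G := space_calculus (group_tot_space hG).
Let rGhat : has_functional_calculus Ghat := fibre_product_calculus _ _.
Let hcov : covering q. Proof. by have [] := hq. Qed.
Let mq : morphism q. Proof. by have [] := hcov. Qed.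
Let ms f : is_section (psi f). Proof. exact: hpsi.1. Qed.
Let cpsi := cocycle psi.
Let pcpsi f y : gproj (cpsi f y) = q y. Proof. exact: cocycle_proj. Qed.

Lemma sigma_morphism f : morphism (sigma psi f).
Proof.
move=> w; apply: fibre_pair_morphism_at => //.
  have -> : (fun w => (val (sigma psi f w)).1) = dfun f \o (fun w : Ghat => (val w).1).
    by apply/funext => w'; rewrite sigmaE.
  exact/morphism_at_comp/fibre_fst_morphism/dfun_morphism.
have -> : (fun w => (val (sigma psi f w)).2) =
    (fun w : Ghat => gmul (cpsi f (val w).1) (val w).2).
  by apply/funext => w'; rewrite sigmaE.
apply: (gmul_morphism_at hG) => //.
- by apply: (filterE (nbhs_filter w)) => w'; rewrite pcpsi fibre_productP.
- apply: (morphism_at_comp (g := cpsi f)); last exact: fibre_fst_morphism.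
  exact: section_snd_morphism.
- exact: fibre_snd_morphism.
Qed.

(** The crossed identity makes c_id(y) idempotent. *)
Lemma cocycle_id y : cpsi (deck_id q) y = gone G (q y).
Proof.
rewrite -(pcpsi (deck_id q)); apply: gmul_idem => //.
rewrite -[X in gmul X _]/(cpsi (deck_id q) (deck_id q y)) -(cocycleM hG) //.
by congr (cocycle psi _ y); exact: deck_ext.
Qed.

Lemma sigma_left_action : left_action (sigma psi).
Proof.
split=> [f|w|f1 f2 w]; first exact: sigma_morphism.
  apply: fibre_product_ext; rewrite sigmaE //=.
  by rewrite -/cpsi cocycle_id fibre_productP group_mul1.
apply: fibre_product_ext; rewrite !sigmaE //= (cocycleM hG) //.
by rewrite group_mulA // !cocycle_proj ?dfun_over ?fibre_productP.
Qed.

Let la := sigma_left_action.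

Lemma twisted_class_morphism : morphism cl.
Proof. exact: orbit_class_morphism. Qed.

Lemma twisted_class_surj (c : T) : exists w : Ghat, cl w = c.
Proof. by exists (orbit_repr c); exact: orbit_reprK. Qed.

Lemma twisted_class_sigma f w : cl (sigma psi f w) = cl w.
Proof. exact: orbit_class_act. Qed.

Lemma twisted_repr w : exists f, orbit_repr (cl w) = sigma psi f w.
Proof.
have /esym/(orbit_class_eq la)[f fw] := orbit_reprK (cl w).
by exists f.
Qed.

Lemma twisted_proj w : rproj (cl w) = q (val w).1.
Proof. by have [f e] := twisted_repr w; rewrite /= e sigmaE //= dfun_over. Qed.

(** The action, defined through a chosen representative of the class, can be
    computed with any representative, since sigma commutes with right
    translations. *)
Lemma twisted_act (w w' : Ghat) g : gproj g = q (val w).1 ->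
  val w' = ((val w).1, gmul (val w).2 g) -> ract (cl w) g = cl w'.
Proof.
move=> pg ew'; have [f e] := twisted_repr w.
set h := sigma psi f w in e; pose v : Ghat := insubd h ((val h).1, g).
have -> : ract (cl w) g = cl (gmul h v) by rewrite /v -e.
rewrite -(twisted_class_sigma f w'); congr (orbit_class _ _).
have ev : val v = ((val h).1, g).
  by rewrite fibre_insubdK // sigmaE // dfun_over pg.
apply: fibre_product_ext; rewrite pullback_mulE // ev // !sigmaE // ew' //=.
by rewrite group_mulA // ?cocycle_proj -?fibre_productP ?pg.
Qed.

(** A deck transformation relating two representatives over the same point has a
    fixed point, and is therefore the identity. *)
Lemma twisted_class_inj w w' : cl w = cl w' -> (val w).1 = (val w').1 -> w = w'.
Proof.
move=> /(orbit_class_eq la)[f <-]; rewrite sigmaE //= => /esym fw.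
have [_ cY _] := hq; have [_ a1 _] := la.
by rewrite (deck_free (g := deck_id q) hcov cY fw) a1.
Qed.

Lemma twisted_class_over (c : T) y : rproj c = q y ->
  exists2 w : Ghat, cl w = c & (val w).1 = y.
Proof.
have [w <-] := twisted_class_surj c.
rewrite twisted_proj => /(deck_transitive hq)[f fy].
by exists (sigma psi f w); rewrite ?twisted_class_sigma // sigmaE.
Qed.

(** The representative of [c] over [y]; the default value is taken only when [c]
    and [y] do not lie over the same point of [X]. *)
Definition twisted_lift (y : Y) (c : T) : Ghat :=
  xget (orbit_repr c) [set w : Ghat | cl w = c /\ (val w).1 = y].

Lemma twisted_liftE w : twisted_lift (val w).1 (cl w) = w.
Proof.
rewrite /twisted_lift; case: xgetP => [w' _ [cw' yw']|/(_ w) //].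
  exact: twisted_class_inj.
by case.
Qed.

Lemma twisted_lift_class y c : rproj c = q y -> cl (twisted_lift y c) = c.
Proof. by move=> /twisted_class_over[w <- <-]; rewrite twisted_liftE. Qed.

Lemma twisted_lift_proj y c : rproj c = q y -> (val (twisted_lift y c)).1 = y.
Proof. by move=> /twisted_class_over[w <- <-]; rewrite twisted_liftE. Qed.

Lemma twisted_proj_morphism : morphism (@rproj _ _ _ _ T).
Proof.
move=> c; have [w <-] := twisted_class_surj c.
apply: (orbit_morphism_at la).
have -> : (fun w => rproj (cl w)) = q \o (fun w : Ghat => (val w).1).
  by apply/funext => w'; rewrite twisted_proj.
exact/morphism_at_comp/fibre_fst_morphism/mq.
Qed.

(** It suffices to check this on a representative [w] of [c].  Some deck
    transformation [f] moves the projection of [w] into the sheet V, and it does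
    the same for all nearby points; there the composite with the quotient map is
    [sigma psi f]. *)
Lemma twisted_lift_morphism_at U V (s : X -> Y) (c : T) :
  open V -> iso_on V U q s -> U (rproj c) ->
  morphism_at (fun c => twisted_lift (s (rproj c)) c : Ghat) c.
Proof.
move=> oV [_ _ sK qK]; have [w <-] := twisted_class_surj c.
rewrite twisted_proj => Uw; apply: (orbit_morphism_at la).
have [Vw qsw] := qK _ Uw.
have [f fw] := deck_transitive hq (esym qsw); rewrite -fw in Vw.
have mfw : morphism_at (dfun f \o (fun w : Ghat => (val w).1)) w.
  exact/morphism_at_comp/fibre_fst_morphism/dfun_morphism.
apply: (morphism_at_near rGhat _ (sigma_morphism f w)).
apply: filterS (near_preimage mfw oV Vw) => w' /= Vw'.
have -> : s (rproj (cl w')) = (val (sigma psi f w')).1.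
  by rewrite twisted_proj sigmaE //= -(dfun_over f); have [_ ->] := sK _ Vw'.
by rewrite -(twisted_class_sigma f w') twisted_liftE.
Qed.

Lemma twisted_act_class (w : Ghat) g : gproj g = q (val w).1 ->
  exists2 w' : Ghat, val w' = ((val w).1, gmul (val w).2 g) &
    ract (cl w) g = cl w'.
Proof.
move=> pg.
have e : q (val w).1 = gproj (gmul (val w).2 g).
  by rewrite group_proj_mul // -fibre_productP.
by exists (fibre_pair e); last exact: twisted_act.
Qed.

(** A section [s] of [q] over U identifies an element [g] of G over U with the
    class of (s(p(g)), g); the inverse is [twisted_lift] along [s]. *)
Lemma twisted_locally_trivial U V (s : X -> Y) (y : Y) :
  open U -> open V -> iso_on V U q s -> right_iso_on U (right_translations G) T.
Proof.
move=> oU oV iV; have [_ ms' sK qK] := iV.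
pose w0 : Ghat := gone Ghat y.
pose emb g : Ghat := insubd w0 (s (gproj g), g).
have embE g : U (gproj g) -> val (emb g) = (s (gproj g), g).
  by move=> /qK[_ e]; exact: fibre_insubdK.
have pe g : U (gproj g) -> rproj (cl (emb g)) = gproj g.
  by move=> Ug; rewrite twisted_proj embE //= (qK _ Ug).2.
exists (fun g => cl (emb g)), (fun c => (val (twisted_lift (s (rproj c)) c)).2).
have mp := group_proj_morphism hG.
split.
- split.
  + move=> g Ug; apply: (morphism_at_comp (f := emb)).
      exact: twisted_class_morphism.
    apply: fibre_insubd_morphism_at => //; last exact: id_morphism.
      by apply: filterS (near_preimage (mp g) oU Ug) => g' /qK[].
    by apply: (morphism_at_comp (g := s)); [exact: ms'|exact: mp].
  + move=> c Uc; apply: (morphism_at_comp (fibre_snd_morphism _)).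
    exact: (twisted_lift_morphism_at oV iV).
  + move=> g Ug; have Upe : U (rproj (cl (emb g))) by rewrite pe.
    split; first exact: Upe.
    have e : s (rproj (cl (emb g))) = (val (emb g)).1 by rewrite pe // embE.
    have : (val (twisted_lift (s (rproj (cl (emb g)))) (cl (emb g)))).2 = g.
      by rewrite e twisted_liftE embE.
    by [].
  + move=> c Uc; have [Vs qs] := qK _ Uc.
    set w := twisted_lift _ _.
    have wy : (val w).1 = s (rproj c) by rewrite twisted_lift_proj.
    have pw : gproj (val w).2 = rproj c by rewrite -fibre_productP wy.
    have -> : emb (val w).2 = w.
      apply: fibre_product_ext; rewrite embE ?pw //.
    by rewrite /= pw twisted_lift_class.
- exact: pe.
- move=> g g' Ug pgg' /=; apply/esym/twisted_act.
    by rewrite embE //= (qK _ Ug).2.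
  by rewrite !embE ?group_proj_mul.
Qed.

Lemma twisted_local_section (x : X) : exists U V (s : X -> Y),
  [/\ open U, open V, U x & iso_on V U q s].
Proof.
have [t tK] := galois_surjective hq.
have [U [V [s [oU oV Vx iV]]]] := covering_local_section (t x) hcov.
exists U, V, s; split=> //.
by have [_ _ /(_ _ Vx)[+ _] _] := iV; rewrite tK.
Qed.

Let rT : has_functional_calculus T := orbit_space_calculus (sigma psi) rGhat.

Lemma twisted_space : is_space T.
Proof.
apply: (locally_iso_space hX (group_tot_space hG) twisted_proj_morphism
  (group_proj_morphism hG) rT) => x.
have [U [V [s [oU oV Ux iV]]]] := twisted_local_section x.
have [phi [phi' [[m1 m2 c1 c2] _ _]]] := twisted_locally_trivial (s x) oU oV iV.
by exists U, phi', phi.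
Qed.

Lemma twisted_act_morphism :
  morphism (fun w : fibre_product (@rproj _ _ _ _ T) (@gproj _ _ _ G) =>
              ract (val w).1 (val w).2).
Proof.
set F := fibre_product _ _ => z0.
have [U [V [s [oU oV Ux iV]]]] := twisted_local_section (rproj (val z0).1).
have [_ _ _ qK] := iV.
pose w0 : Ghat := orbit_repr (val z0).1.
(* Locally the action is right multiplication of the representatives along s. *)
pose h (z : F) : Ghat := twisted_lift (s (rproj (val z).1)) (val z).1.
have nU : \forall z \near z0, U (rproj (val z).1).
  apply: (@near_preimage _ _ _ _ (fun z : F => rproj (val z).1)) => //.
  exact: (morphism_at_comp (twisted_proj_morphism _) (fibre_fst_morphism _)).
have mh : morphism_at h z0.
  apply: (morphism_at_comp (f := fun z : F => (val z).1)
    (g := fun c => twisted_lift (s (rproj c)) c : Ghat)).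
    exact: twisted_lift_morphism_at oV iV Ux.
  exact: fibre_fst_morphism.
have hE z : U (rproj (val z).1) -> [/\ cl (h z) = (val z).1,
    q (val (h z)).1 = rproj (val z).1 & gproj (val (h z)).2 = gproj (val z).2].
  move=> /qK[_ qs]; split; first exact: twisted_lift_class.
    by rewrite twisted_lift_proj.
  by rewrite -fibre_productP twisted_lift_proj // qs fibre_productP.
pose m z : Ghat := insubd w0 ((val (h z)).1, gmul (val (h z)).2 (val z).2).
have mE z : U (rproj (val z).1) -> ract (val z).1 (val z).2 = cl (m z).
  move=> /hE[hz qh ph]; rewrite -[X in ract X]hz; apply: twisted_act.
    by rewrite qh fibre_productP.
  by apply: fibre_insubdK; rewrite group_proj_mul // ph qh fibre_productP.
have rF : has_functional_calculus F by exact: fibre_product_calculus.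
apply: (@morphism_at_near _ _ _ _ (fun z => cl (m z))) => //.
  by apply: filterS nU => z Uz; rewrite mE.
apply: (morphism_at_comp (f := m)); first exact: twisted_class_morphism.
apply: fibre_insubd_morphism_at => //.
- apply: filterS nU => z /hE[_ qh ph].
  by rewrite group_proj_mul // fibre_productP.
- exact: (morphism_at_comp (fibre_fst_morphism _) mh).
- apply: (gmul_morphism_at hG) => //.
  + by apply: filterS nU => z /hE[].
  + exact: (morphism_at_comp (fibre_snd_morphism _) mh).
  + exact: fibre_snd_morphism.
Qed.

Lemma twisted_right_space : is_right_space T.
Proof.
split.
- exact: twisted_space.
- exact: twisted_proj_morphism.
- exact: twisted_act_morphism.
- move=> c g; have [w <-] := twisted_class_surj c; rewrite twisted_proj => /esym pg.
  by have [w' ew' ->] := twisted_act_class pg; rewrite !twisted_proj ew'.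
- move=> c; have [w <-] := twisted_class_surj c; rewrite twisted_proj.
  apply: twisted_act; first by rewrite gproj_one.
  by rewrite fibre_productP group_mulr1 // -surjective_pairing.
- move=> c g g'; have [w <-] := twisted_class_surj c; rewrite twisted_proj => pg pgg'.
  have [w1 e1 ->] := twisted_act_class (esym pg).
  have pw : gproj (val w).2 = gproj g by rewrite -fibre_productP.
  have pg' : gproj g' = q (val w1).1 by rewrite e1 -pgg'.
  have [w2 e2 ->] := twisted_act_class pg'.
  apply: twisted_act; first by rewrite group_proj_mul.
  by rewrite e2 e1 /= group_mulA.
Qed.

Lemma twisted_torsor : is_torsor T.
Proof.
split; first exact: twisted_right_space.
move=> x; have [U [V [s [oU oV Ux iV]]]] := twisted_local_section x.
by exists U; split=> //; exact: twisted_locally_trivial (s x) oU oV iV.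
Qed.

(** Near a point, the first coordinate of the pullback is the value at the second
    one of a local section of [q], which reduces this to
    [twisted_lift_morphism_at]. *)
Lemma twisted_lift_pullback_morphism :
  morphism (fun z : pullback_right q T => twisted_lift (val z).1 (val z).2 : Ghat).
Proof.
move=> z; have [U [V [s [oU oV Vz iV]]]] := covering_local_section (val z).1 hcov.
have [_ _ sK _] := iV.
have rz : has_functional_calculus (pullback_right q T) by exact: fibre_product_calculus.
have n := near_preimage (fibre_fst_morphism z) oV Vz.
have [Uz _] := sK _ Vz; rewrite fibre_productP in Uz.
apply: (morphism_at_near rz _ (morphism_at_comp
  (twisted_lift_morphism_at oV iV Uz) (fibre_snd_morphism z))).
apply: filterS n => z' /sK[_]; rewrite fibre_productP => e.
suff : twisted_lift (s (rproj (val z').2)) (val z').2 =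
    twisted_lift (val z').1 (val z').2 by [].
by rewrite e.
Qed.

Lemma twisted_pullback_trivial : trivial_torsor (pullback_right q T).
Proof.
have e (w : Ghat) : q (val w).1 = rproj (cl w) by rewrite twisted_proj.
exists (fun z => twisted_lift (val z).1 (val z).2),
  (fun w : Ghat => @fibre_pair _ _ _ _ _ q (@rproj _ _ _ _ T) _ _ (e w)).
split.
- split.
  + by move=> z _; exact: twisted_lift_pullback_morphism.
  + move=> w _; apply: fibre_pair_morphism_at => //.
      exact: fibre_fst_morphism.
    exact: twisted_class_morphism.
  + move=> z _; split=> //; have /esym ez := fibre_productP z.
    by apply: fibre_product_ext => /=; rewrite ?twisted_lift_proj ?twisted_lift_class.
  + by move=> w _; split=> //=; rewrite twisted_liftE.
- by move=> z _; apply: twisted_lift_proj; exact: esym (fibre_productP z).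
- move=> z g _ zg; have /esym/twisted_class_over[w wc wy] := fibre_productP z.
  have pg : gproj (val g).2 = q (val w).1 
    by rewrite -fibre_productP wy; congr q; exact: esym zg.
  have [w' ew' ew] := twisted_act_class pg.
  have ez : val (ract z g : pullback_right q T) = ((val w').1, cl w').
    rewrite -ew; rewrite ew' wy wc; apply: fibre_insubdK.
    by rewrite -wc ew twisted_proj ew' wy.
  rewrite ez twisted_liftE -wy -wc twisted_liftE.
  apply: fibre_product_ext; rewrite /= -/(gmul w g) pullback_mulE ?ew' //.
    by rewrite wy.
  by rewrite wy.
Qed.

Lemma twisted_trivialized : trivialized_torsor q T.
Proof. split; [exact: twisted_torsor|exact: twisted_pullback_trivial]. Qed.

End TwistedQuotient.

(** * Isomorphism classes *)

Section RightIsomorphisms.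
Context {R : realType} {k : category} {X : catSpace R k} {G : group_data X}.
Implicit Types P : right_data G.

Lemma right_iso_refl P : right_iso P P.
Proof. by exists id, id; split=> //; split=> // z _; exact: id_morphism. Qed.

Lemma right_iso_sym P P' : right_iso P P' -> right_iso P' P.
Proof.
move=> [f [g [[mf mg fK gK] pf af]]].
have gfK z : g (f z) = z by have [_] := fK z I.
have fgK z : f (g z) = z by have [_] := gK z I.
exists g, f; split; first by split.
  by move=> z _; rewrite -(pf (g z) I) fgK.
move=> z h _ zh; rewrite -[in LHS](fgK z) -af ?gfK //.
by rewrite -(pf (g z) I) fgK.
Qed.

Lemma right_iso_trans P P' P'' :
  right_iso P P' -> right_iso P' P'' -> right_iso P P''.
Proof.
move=> [f [g [[mf mg fK gK] pf af]]] [f' [g' [[mf' mg' fK' gK'] pf' af']]].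
exists (f' \o f), (g \o g'); split.
- split=> z _.
  + by apply: morphism_at_comp; [exact: mf'|exact: mf].
  + by apply: morphism_at_comp; [exact: mg|exact: mg'].
  + by split=> //=; rewrite (fK' (f z) I).2 (fK z I).2.
  + by split=> //=; rewrite (gK (g' z) I).2 (gK' z I).2.
- by move=> z _; rewrite /= pf' // pf.
- by move=> z h _ zh; rewrite /= af // af' // pf.
Qed.

Context {Y : catSpace R k} {q : Y -> X}.

Lemma iso_class_eq P P' : trivialized_torsor q P -> trivialized_torsor q P' ->
  iso_class q P = iso_class q P' <-> right_iso P P'.
Proof.
move=> tP tP'; split=> [e|PP'].
  have : iso_class q P' P' by split; [|exact: right_iso_refl].
  by rewrite -e => -[].
apply/funext => P''; apply/propext; split=> -[tP'' PP'']; split=> //.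
  exact: right_iso_trans (right_iso_sym PP') PP''.
exact: right_iso_trans PP' PP''.
Qed.

End RightIsomorphisms.

(** * Framings and descent *)

Section Descent.
Context {R : realType} {k : category} {X Y : catSpace R k}.
Context {G : group_data X} {q : Y -> X}.
Context (hY : is_space Y) (hG : is_group_space G) (hq : galois_cover q).
Local Notation Ghat := (pullback_group G q).

(** A trivialisation of q^*P, in the form used for descent: [Phi] is the
    isomorphism from q^*P to q^*G and [b] the second component of its inverse,
    the first component being the projection to Y. *)
Record framing (P : right_data G) (b : Ghat -> P) (Phi : pullback_right q P -> Ghat) :
    Prop := {
  framing_morphism : morphism b;
  framing_inv_morphism : morphism Phi;
  framing_proj (w : Ghat) : rproj (b w) = q (val w).1;
  framing_act (w w' : Ghat) g : gproj g = q (val w).1 ->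
    val w' = ((val w).1, gmul (val w).2 g) -> b w' = ract (b w) g;
  framing_inv_proj (z : pullback_right q P) : (val (Phi z)).1 = (val z).1;
  framingK (w : Ghat) (z : pullback_right q P) : val z = ((val w).1, b w) -> Phi z = w;
  framing_invK (z : pullback_right q P) : b (Phi z) = (val z).2
}.

Lemma framing_inj P b Phi w w' : @framing P b Phi ->
  (val w).1 = (val w').1 -> b w = b w' -> w = w'.
Proof.
move=> fb ww' bb'; have e := esym (framing_proj fb w).
have <- : Phi (fibre_pair e) = w by exact: (framingK fb).
by apply: (framingK fb); rewrite /= ww' bb'.
Qed.

Lemma trivial_pullback_framing (P : right_data G) : is_right_space P ->
  trivial_torsor (pullback_right q P) -> exists b Phi, @framing P b Phi.
Proof.
move=> hP tP; have [b [Phi [[mb mPhi bK PhiK] pb ab]]] := right_iso_sym tP.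
have {}pb w : (val (b w)).1 = (val w).1 by exact: pb.
exists (fun w => (val (b w)).2), Phi; split.
- by move=> w; have := morphism_at_comp (fibre_snd_morphism (b w)) (mb w I).
- by move=> z; exact: mPhi.
- by move=> w; rewrite -fibre_productP pb.
- move=> w w' g pg ew'.
  have eg : q (val w).1 = gproj g by [].
  have -> : w' = gmul w (fibre_pair eg).
    by apply: fibre_product_ext; rewrite pullback_mulE // ew'.
  have -> : b (gmul w (fibre_pair eg)) = ract (b w) (fibre_pair eg : Ghat).
    by apply: ab.
  have pw : rproj (val (b w)).2 = gproj g by rewrite -fibre_productP pb eg.
  by rewrite fibre_insubdK //= right_proj_act // fibre_productP.
- by move=> z; rewrite -[in RHS](PhiK z I).2 pb.
- move=> w z ez; suff -> : z = b w by have [_] := bK w I.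
  by apply: fibre_product_ext; rewrite ez //= pb.
- by move=> z; have [_ ->] := PhiK z I.
Qed.

Section Quotient.
Context {psi : deck q -> Y -> Ghat} (hpsi : crossed_morphism psi).

Lemma twisted_framing :
  framing (P := twisted_quotient psi) (orbit_class (sigma psi))
    (fun z => twisted_lift (val z).1 (val z).2).
Proof.
split.
- exact: twisted_class_morphism.
- exact: twisted_lift_pullback_morphism.
- exact: twisted_proj.
- by move=> w w' g pg ew'; apply/esym/twisted_act.
- by move=> z; apply: twisted_lift_proj => //; exact: esym (fibre_productP z).
- by move=> w z -> /=; exact: twisted_liftE.
- by move=> z; apply: twisted_lift_class => //; exact: esym (fibre_productP z).
Qed.

(** The framing [b] induces the map from the quotient.  The inverse sends [z] to the
    class of [Phi (y, z)] for any y over the image of [z]: two choices of y differ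
    by a deck transformation, and invariance of [b] shows that [sigma] relates the
    corresponding points.  A local section of [q] supplies y as a morphism near
    each point. *)
Lemma twisted_quotient_iso (P : right_data G) b Phi : is_right_space P ->
  @framing P b Phi -> (forall f w, b (sigma psi f w) = b w) ->
  right_iso (twisted_quotient psi) P.
Proof.
move=> hP fb bs.
have rP : has_functional_calculus P := space_calculus (right_tot_space hP).
have [t tK] := galois_surjective hq.
pose cl : Ghat -> twisted_quotient psi := orbit_class (sigma psi).
have bcl w : b (orbit_repr (cl w)) = b w.
  by have [f e] := twisted_repr hG hpsi w; rewrite e bs.
have e (z : P) : q (t (rproj z)) = rproj z by [].
pose phi' (z : P) : twisted_quotient psi := cl (Phi (fibre_pair (e z))).
(* Independence of the choice of y. *)
have phi'E (z : pullback_right q P) : cl (Phi z) = phi' (val z).2.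
  set z' := fibre_pair (e (val z).2).
  have qq : q (val (Phi z)).1 = q (val (Phi z')).1.
    by rewrite !(framing_inv_proj fb) !fibre_productP.
  have [f fe] := deck_transitive hq qq.
  rewrite /phi' -/z' -[LHS](twisted_class_sigma hG hpsi f); congr (cl _).
  apply: (framing_inj fb); first by rewrite (sigmaE hG _ (hpsi.1 f)).
  by rewrite bs !(framing_invK fb).
have clE c : exists w, cl w = c by exact: twisted_class_surj.
exists (fun c => b (orbit_repr c)), phi'; split.
- split.
  + move=> c _; have [w <-] := clE c.
    apply: (orbit_morphism_at (sigma_left_action hG hpsi)).
    have -> : (fun w => b (orbit_repr (orbit_class (sigma psi) w))) = b by exact/funext.
    exact: framing_morphism fb w.
  + move=> z _.
    have [U [V [s [oU oV Uz iV]]]] := twisted_local_section hq (rproj z).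
    have [_ ms sK qK] := iV.
    have mp := right_proj_morphism hP z.
    have nU := near_preimage mp oU Uz.
    pose pr z' : pullback_right q P := insubd (fibre_pair (e z)) (s (rproj z'), z').
    have mpr : morphism_at pr z.
      apply: fibre_insubd_morphism_at => //; last exact: id_morphism.
        by apply: filterS nU => z' /qK[].
      by apply: (morphism_at_comp (g := s)); [exact: ms|exact: mp].
    have mcl := morphism_at_comp (twisted_class_morphism (psi := psi) _)
      (morphism_at_comp (framing_inv_morphism fb (pr z)) mpr).
    apply: (morphism_at_near rP _ mcl).
    by apply: filterS nU => z' /qK[_ qs]; rewrite [LHS]phi'E fibre_insubdK.
  + move=> c _; split=> //; have [w <-] := clE c.
    rewrite bcl.
    have ew := esym (framing_proj fb w).
    have <- := phi'E (fibre_pair ew).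
    by rewrite (framingK fb (w := w)).
  + by move=> z _; split=> //; rewrite bcl (framing_invK fb).
- move=> c _; have [w <-] := clE c.
  by rewrite bcl (framing_proj fb) twisted_proj.
- move=> c g _; have [w <-] := clE c; rewrite twisted_proj // => /esym pg.
  have [w' ew' ->] := twisted_act_class hG hpsi pg.
  by rewrite !bcl; exact: (framing_act fb pg ew').
Qed.

End Quotient.

Lemma pullback_one_morphism : morphism (gone Ghat).
Proof.
move=> y; apply: fibre_pair_morphism_at; first exact: space_calculus.
  exact: id_morphism.
have [[mq _] _ _] := hq.
exact: (morphism_at_comp (group_one_morphism hG (q y)) (mq y)).
Qed.

(** The canonical deck action on q^*P, transported to q^*G by the framing, is the
    action sigma of the crossed morphism found here. *)
Lemma framing_twist (P : right_data G) b Phi : @framing P b Phi ->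
  exists2 psi : deck q -> Y -> Ghat, crossed_morphism psi &
    forall f w, b (sigma psi f w) = b w.
Proof.
move=> fb.
have e (f : deck q) y : q (f y) = rproj (b (gone Ghat y)).
  by rewrite (framing_proj fb) dfun_over.
(* The point over f y that b maps to b (y, 1); its component in G is c_f(y). *)
pose lift f y : Ghat := Phi (fibre_pair (e f y)).
pose c f y : G := (val (lift f y)).2.
have liftE f y : val (lift f y) = (f y, c f y).
  by rewrite /c [LHS]surjective_pairing (framing_inv_proj fb).
have blift f y : b (lift f y) = b (gone Ghat y) by rewrite (framing_invK fb).
have pc f y : q y = gproj (c f y) by rewrite -fibre_productP liftE dfun_over.
have mc f : morphism (c f).
  move=> y; apply: (morphism_at_comp (fibre_snd_morphism _) (f := lift f)).
  apply: (morphism_at_comp (framing_inv_morphism fb _)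
    (f := fun y => fibre_pair (e f y) : pullback_right q P)).
  apply: fibre_pair_morphism_at; first exact: space_calculus.
    exact: dfun_morphism.
  exact: (morphism_at_comp (framing_morphism fb _) (pullback_one_morphism y)).
have cM f1 f2 y : c (deck_comp f1 f2) y = gmul (c f1 (f2 y)) (c f2 y).
  have pc1 : gproj (c f1 (f2 y)) = q y by rewrite -pc dfun_over.
  have e12 : q (deck_comp f1 f2 y) = gproj (gmul (c f1 (f2 y)) (c f2 y)).
    by rewrite dfun_over group_proj_mul ?pc1 // -pc.
  suff /(congr1 (fun w : Ghat => (val w).2)) :
    lift (deck_comp f1 f2) y = fibre_pair e12 :> Ghat by [].
  apply: (framing_inj fb); first by rewrite liftE.
  have p2 : gproj (c f2 y) = q (val (lift f1 (f2 y))).1.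
    by rewrite liftE !dfun_over.
  rewrite [RHS](framing_act fb (w := lift f1 (f2 y)) p2); last by rewrite liftE.
  rewrite !blift -(blift f2); apply: (framing_act fb); first by rewrite -pc dfun_over.
  by rewrite liftE /= dfun_over (pc f2) group_mul1.
have [psi hpsi psiE] := crossed_of_cocycle hG (space_calculus hY) mc pc cM.
exists psi => // f w.
have pw : gproj (val w).2 = q (val (lift f (val w).1)).1.
  by rewrite liftE dfun_over fibre_productP.
rewrite (framing_act fb (w := lift f (val w).1) pw); last first.
  by rewrite (sigmaE hG _ (hpsi.1 f)) liftE psiE.
rewrite blift; apply/esym/(framing_act fb); first by rewrite -fibre_productP.
by rewrite /= fibre_productP group_mul1 // -surjective_pairing.
Qed.

(** Left multiplication by a section is an automorphism of q^*G as a right torsor. *)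
Lemma framing_gauge (P : right_data G) b Phi (alpha : Y -> Ghat) :
  @framing P b Phi -> is_section alpha ->
  framing (P := P) (fun w => b (gmul (alpha (val w).1) w))
    (fun z => gmul (ginv (alpha (val z).1)) (Phi z)).
Proof.
move=> fb sa.
have aE (w : Ghat) : val (gmul (alpha (val w).1) w) =
    ((val w).1, gmul (val (alpha (val w).1)).2 (val w).2).
  by rewrite pullback_mulE ?section_proj.
have aVE (z : pullback_right q P) : val (gmul (ginv (alpha (val z).1)) (Phi z)) =
    ((val z).1, gmul (ginv (val (alpha (val z).1)).2) (val (Phi z)).2).
  by rewrite pullback_mulE // pullback_invE //= ?(framing_inv_proj fb) section_proj.
have aP (w : Ghat) : gproj (val (alpha (val w).1)).2 = gproj (val w).2.
  by rewrite section_gproj // fibre_productP.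
have aQ (z : pullback_right q P) :
    gproj (val (alpha (val z).1)).2 = gproj (val (Phi z)).2.
  by rewrite section_gproj // -(framing_inv_proj fb) fibre_productP.
split.
- move=> w; apply: (morphism_at_comp (framing_morphism fb _)
    (f := fun w : Ghat => gmul (alpha (val w).1) w)).
  apply: fibre_pair_morphism_at; first exact: fibre_product_calculus.
    have -> : (fun w : Ghat => (val (gmul (alpha (val w).1) w)).1) =
        (fun w => (val w).1).
      by apply/funext => w'; rewrite aE.
    exact: fibre_fst_morphism.
  have -> : (fun w : Ghat => (val (gmul (alpha (val w).1) w)).2) =
      (fun w => gmul (val (alpha (val w).1)).2 (val w).2).
    by apply/funext => w'; rewrite aE.
  apply: (gmul_morphism_at hG); first exact: fibre_product_calculus.
  + by apply: (filterE (nbhs_filter w)) => w'; exact: aP.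
  + apply: (morphism_at_comp (g := fun y => (val (alpha y)).2)).
      exact: section_snd_morphism.
    exact: fibre_fst_morphism.
  + exact: fibre_snd_morphism.
- move=> z; apply: fibre_pair_morphism_at; first exact: fibre_product_calculus.
    have -> : (fun z => (val (gmul (ginv (alpha (val z).1)) (Phi z))).1) =
        (fun z : pullback_right q P => (val z).1) by apply/funext => z'; rewrite aVE.
    exact: fibre_fst_morphism.
  have -> : (fun z => (val (gmul (ginv (alpha (val z).1)) (Phi z))).2) =
      (fun z : pullback_right q P =>
         gmul (ginv (val (alpha (val z).1)).2) (val (Phi z)).2).
    by apply/funext => z'; rewrite aVE.
  apply: (gmul_morphism_at hG); first exact: fibre_product_calculus.
  + by apply: (filterE (nbhs_filter z)) => z'; rewrite group_proj_inv.
  + apply: (morphism_at_comp (group_inv_morphism hG _)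
      (f := fun z : pullback_right q P => (val (alpha (val z).1)).2)).
    apply: (morphism_at_comp (g := fun y => (val (alpha y)).2)).
      exact: section_snd_morphism.
    exact: fibre_fst_morphism.
  + exact: (morphism_at_comp (fibre_snd_morphism _) (framing_inv_morphism fb z)).
- by move=> w; rewrite (framing_proj fb) aE.
- move=> w w' g pg ew'; apply: (framing_act fb); first by rewrite aE.
  have aw' : (val w').1 = (val w).1 by rewrite ew'.
  by rewrite !aE aw' ew' /= group_mulA ?aP ?pg ?fibre_productP.
- by move=> z; rewrite aVE.
- move=> w z ez; apply: fibre_product_ext; rewrite aVE ez //=.
  have -> : Phi z = gmul (alpha (val w).1) w.
    by apply: (framingK fb); rewrite ez aE.
  by rewrite aE /= (gmulK hG) ?aP.
- move=> z; rewrite -(framing_invK fb); congr b; apply: fibre_product_ext.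
    by rewrite aE aVE (framing_inv_proj fb).
  by rewrite aE aVE /= (gmulVK hG) ?aQ.
Qed.

(** Left multiplication by [alpha] intertwines the two actions exactly when [alpha]
    conjugates [psi] into [psi']. *)
Lemma twisted_iso_conjugate (hX : is_space X) (psi psi' : deck q -> Y -> Ghat) :
  crossed_morphism psi -> crossed_morphism psi' ->
  right_iso (twisted_quotient psi) (twisted_quotient psi') <-> conjugate psi psi'.
Proof.
move=> hpsi hpsi'; rewrite (conjugateP hG hpsi hpsi').
have [sp sp'] : (forall f, is_section (psi f)) /\ (forall f, is_section (psi' f)).
  by split=> f; [exact: hpsi.1|exact: hpsi'.1].
have fr := twisted_framing hpsi'.
pose cl w : twisted_quotient psi := orbit_class (sigma psi) w.
pose cl' w : twisted_quotient psi' := orbit_class (sigma psi') w.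
split=> [[phi [phi' [[mphi _ _ _] pphi aphi]]]|[alpha sa conj]]; last first.
  have ralpha := framing_gauge fr sa.
  apply: (twisted_quotient_iso hpsi _ ralpha).
    exact: twisted_right_space.
  move=> f w; rewrite -[RHS](twisted_class_sigma hG hpsi' f).
  have pc : gproj (cocycle psi f (val w).1) = gproj (val w).2.
    by rewrite cocycle_proj // fibre_productP.
  have pc' : gproj (cocycle psi' f (val w).1) = gproj (val w).2.
    by rewrite cocycle_proj // fibre_productP.
  have pa y : gproj (val (alpha y)).2 = q y by exact: section_gproj.
  congr (orbit_class _ _); apply: fibre_product_ext.
    rewrite pullback_mulE ?section_proj // !(sigmaE hG) //.
    by rewrite pullback_mulE ?section_proj.
  rewrite pullback_mulE ?section_proj // !(sigmaE hG) //=.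
  rewrite pullback_mulE ?section_proj //=.
  rewrite !group_mulA ?pc ?pc' ?pa ?dfun_over ?fibre_productP //.
  by rewrite conj.
pose one y : Ghat := gone Ghat y.
have e y : q y = rproj (phi (cl (one y))) by rewrite pphi // twisted_proj.
pose alpha y : Ghat := twisted_lift y (phi (cl (one y))).
have alphaE y : (val (alpha y)).1 = y by exact: twisted_lift_proj.
have clalpha y : cl' (alpha y) = phi (cl (one y)) by exact: twisted_lift_class.
have sa : is_section alpha.
  split=> // y.
  apply: (morphism_at_comp (framing_inv_morphism fr (fibre_pair (e y)))
    (f := fun y => fibre_pair (e y) : pullback_right q (twisted_quotient psi'))).
  apply: fibre_pair_morphism_at; first exact: space_calculus.
    exact: id_morphism.
  apply: (morphism_at_comp (mphi _ I) (f := fun y => cl (one y))).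
  exact: (morphism_at_comp (twisted_class_morphism _) (pullback_one_morphism y)).
(* By equivariance, phi is left multiplication by alpha on representatives. *)
have key w : phi (cl w) = cl' (gmul (alpha (val w).1) w).
  have pw : gproj (val w).2 = q (val (one (val w).1)).1 by rewrite -fibre_productP.
  have -> : cl w = ract (cl (one (val w).1)) (val w).2.
    apply/esym/twisted_act => //.
    by rewrite /= fibre_productP group_mul1 // -surjective_pairing.
  rewrite aphi ?twisted_proj // -clalpha; apply: twisted_act => //.
    by rewrite alphaE -fibre_productP.
  by rewrite pullback_mulE // alphaE.
exists alpha => // f y.
(* Both sides lie over f y and represent the image of the class of (y, 1). *)
suff : sigma psi' f (alpha y) = gmul (alpha (f y)) (sigma psi f (one y)) :> Ghat.
  move=> /(congr1 val); rewrite (sigmaE hG) // pullback_mulE ?(sigmaE hG) ?alphaE //=.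
  by move=> [->]; rewrite -(cocycle_proj y (sp f)) group_mulr1.
have sf : (val (sigma psi f (one y))).1 = f y by rewrite (sigmaE hG).
apply: (twisted_class_inj hG hq hpsi').
  have := key (sigma psi f (one y)); rewrite sf /cl' => <-.
  by rewrite /cl !twisted_class_sigma // clalpha.
by rewrite (sigmaE hG) // pullback_mulE ?alphaE ?sf.
Qed.

End Descent.

(** * Classification *)

Theorem theorem3p14 (R : realType) (k : category) (X Y : catSpace R k)
    (G : group_data X) (q : Y -> X)
    (hX : is_space X) (hXc : connected [set: X]) (hG : is_group_space G)
    (hY : is_space Y) (hq : galois_cover q) :
  [/\ (* sigma is a left action, and its quotient is a torsor which becomes
         trivial after pullback *)
      (forall psi : deck q -> Y -> pullback_group G q, crossed_morphism psi ->
         left_action (sigma psi) /\ trivialized_torsor q (twisted_quotient psi)),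
      (forall P : right_data G, is_torsor P ->
         right_iso (pullback_right q P)
                   (right_translations (pullback_group G q)) ->
         exists2 psi : deck q -> Y -> pullback_group G q,
           crossed_morphism psi & right_iso P (twisted_quotient psi)),
      (forall psi psi' : deck q -> Y -> pullback_group G q,
         crossed_morphism psi -> crossed_morphism psi' ->
         (right_iso (twisted_quotient psi) (twisted_quotient psi') <->
          conjugate psi psi')) &
      (* the induced bijection *)
      exists2 F : ((deck q -> Y -> pullback_group G q) -> Prop) ->
                  (right_data G -> Prop),
        bijective_between (@H1 R k X Y G q) (@trivialized_iso_class R k X Y G q) F &
        forall psi, crossed_morphism psi ->
          F (cohomology_class psi) = iso_class q (twisted_quotient psi)].
Proof.
have triv psi := @twisted_trivialized _ _ _ _ _ _ hX hG hq psi.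
have torsor_twisted (P : right_data G) : is_torsor P ->
    trivial_torsor (pullback_right q P) ->
    exists2 psi : deck q -> Y -> pullback_group G q,
      crossed_morphism psi & right_iso P (twisted_quotient psi).
  move=> [hP _] tP; have [b [Phi fb]] := trivial_pullback_framing hG hP tP.
  have [psi hpsi bpsi] := framing_twist hY hG hq fb.
  by exists psi => //; exact/right_iso_sym/(twisted_quotient_iso hG hq hpsi hP fb).
have isoP psi psi' := @twisted_iso_conjugate _ _ _ _ _ _ hY hG hq hX psi psi'.
split=> // [psi hpsi|].
  by split; [exact: sigma_left_action|exact: triv].
(* The value on the class of psi does not depend on psi; defined by existence, F
   needs no choice of a representative. *)
pose F (C : (deck q -> Y -> pullback_group G q) -> Prop) : right_data G -> Prop :=
  fun P' => exists2 psi, C psi & iso_class q (twisted_quotient psi) P'.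
have FE psi : crossed_morphism psi ->
    F (cohomology_class psi) = iso_class q (twisted_quotient psi).
  move=> hpsi; apply/funext => P'; apply/propext; split.
    move=> [psi' [hpsi' /(isoP _ _ hpsi hpsi')]].
    by move=> /(iso_class_eq (triv _ hpsi) (triv _ hpsi')) ->.
  move=> hP'; exists psi => //; split=> //; apply/isoP => //.
  exact: right_iso_refl.
exists F => //; split.
- by move=> _ [psi hpsi ->]; exists (twisted_quotient psi); [exact: triv|exact: FE].
- move=> _ _ [psi hpsi ->] [psi' hpsi' ->]; rewrite !FE //.
  move=> /(iso_class_eq (triv _ hpsi) (triv _ hpsi')) pp'.
  apply/funext => chi; apply/propext; split=> -[hchi].
    move=> /(isoP _ _ hpsi hchi) pc; split=> //; apply/isoP => //.
    exact: right_iso_trans (right_iso_sym pp') pc.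
  move=> /(isoP _ _ hpsi' hchi) pc; split=> //; apply/isoP => //.
  exact: right_iso_trans pp' pc.
- move=> _ [P tP ->]; have [psi hpsi Ppsi] := torsor_twisted P tP.1 tP.2.
  exists (cohomology_class psi); first by exists psi.
  by rewrite FE //; apply/esym/iso_class_eq => //; exact: triv.
Qed.
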